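(* Let $p\in(1,\infty)$. Each operator in $\mathscr{WCG}(\mathcal{J}_p(\omega_1))$ is a sum of three commutators in $\mathscr{B}(\mathcal{J}_p(\omega_1))$.
   Context: Scalars: $\mathbb{K}=\mathbb{R}$ or $\mathbb{C}$. For $x\colon[0,\omega_1)\to\mathbb{K}$ put $\|x\|_{p,0}=\sup\big(\sum_{j=1}^n|x(\alpha_j)-x(\alpha_{j-1})|^p\big)^{1/p}$, the supremum over $n\in\mathbb{N}$ and $0\leqslant\alpha_0<\dots<\alpha_n<\omega_1$. The long James space $\mathcal{J}_p(\omega_1)$ is the Banach space (under $\|\cdot\|_{p,0}$ or an equivalent norm) of continuous functions $x\colon[0,\omega_1)\to\mathbb{K}$ with $\lim_{\alpha\to\omega_1}x(\alpha)=0$ and $\|x\|_{p,0}<\infty$. A Banach space is weakly compactly generated (WCG) if it contains a weakly compact subset with dense linear span; $\mathscr{WCG}(X)$ is the set of bounded operators on $X$ whose range is contained in a closed subspace of $X$ that is a WCG Banach space. An element $x$ of an algebra $\mathscr{A}$ is a commutator if $x=ab-ba$ for some $a,b\in\mathscr{A}$. *)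

(* Defs.v *)
From HB Require Import structures.
From mathcomp Require Import all_boot all_order all_algebra.
From mathcomp Require Import all_classical all_reals all_analysis lra.
From mathcomp.real_closed Require Import complex.

Set Implicit Arguments.
Unset Strict Implicit.
Unset Printing Implicit Defensive.

Import Order.TTheory GRing.Theory Num.Theory.
Import numFieldNormedType.Exports.

Local Open Scope classical_set_scope.
Local Open Scope ring_scope.

Variant scalar_kind := RealScalars | ComplexScalars.

Definition scalar_field (R : realType) (k : scalar_kind) : numFieldType :=
  match k with RealScalars => R | ComplexScalars => R[i] end.

Definition of_real (R : realType) (k : scalar_kind) : R -> scalar_field R k :=
  match k with
  | RealScalars => fun r => r
  | ComplexScalars => fun r => Complex r 0
  end.

(* The norm of a numFieldType takes its values in the field itself; [modulus]
   is the same absolute value, seen as a real number ([of_real_modulus]). *)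
Definition modulus (R : realType) (k : scalar_kind) :
    scalar_field R k -> R :=
  match k with
  | RealScalars => fun z : R => `|z|
  | ComplexScalars => fun z : R[i] => complex.Re `|z|
  end.

Section ScalarTheory.
Context (R : realType) (k : scalar_kind).
Notation K := (scalar_field R k).
Implicit Types (r s : R) (z w : K).

Lemma of_real_modulus z : of_real k (modulus z) = `|z|.
Proof. by case: k z. Qed.

Lemma le_of_real r s : (of_real k r <= of_real k s) = (r <= s).
Proof. by case: k => //=; exact: lecR. Qed.

Lemma lt_of_real r s : (of_real k r < of_real k s) = (r < s).
Proof. by case: k => //=; exact: ltcR. Qed.

Lemma of_realD r s : of_real k (r + s) = of_real k r + of_real k s.
Proof. by case: k => //=; exact: (rmorphD (real_complex R)). Qed.

Lemma of_realM r s : of_real k (r * s) = of_real k r * of_real k s.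
Proof. by case: k => //=; exact: (rmorphM (real_complex R)). Qed.

Lemma of_real0 : of_real k 0 = 0 :> K. Proof. by case: k. Qed.

Lemma of_real_inj : injective (@of_real R k).
Proof.
by move=> r s rs; apply/eqP; rewrite eq_le -!le_of_real rs lexx.
Qed.

Lemma modulus_ge0 z : 0 <= modulus z.
Proof. by rewrite -le_of_real of_real_modulus of_real0. Qed.

Lemma modulusD z w : modulus (z + w) <= modulus z + modulus w.
Proof. by rewrite -le_of_real of_realD !of_real_modulus ler_normD. Qed.

Lemma modulusM z w : modulus (z * w) = modulus z * modulus w.
Proof. by apply: of_real_inj; rewrite of_realM !of_real_modulus normrM. Qed.

Lemma modulus0 : modulus (0 : K) = 0.
Proof. by apply: of_real_inj; rewrite of_real_modulus of_real0 normr0. Qed.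

Lemma modulus0_eq0 z : modulus z = 0 -> z = 0.
Proof.
by move=> z0; apply/normr0_eq0; rewrite -of_real_modulus z0 of_real0.
Qed.

Lemma modulusN z : modulus (- z) = modulus z.
Proof. by apply: of_real_inj; rewrite !of_real_modulus normrN. Qed.

Lemma pos_of_real (e : K) : 0 < e -> exists2 r, 0 < r & e = of_real k r.
Proof.
move=> e0; exists (modulus e); last by rewrite of_real_modulus gtr0_norm.
by rewrite -lt_of_real of_real_modulus of_real0 gtr0_norm.
Qed.

End ScalarTheory.

Lemma complex_cauchy_cvg (R : realType) (F : set_system (scalar_field R ComplexScalars)) :
  ProperFilter F -> cauchy F -> cvg F.
Proof.
move=> FF /cauchyP Fc.
have abs_le (z : R[i]) (r : R) : `|z| < r%:C%C ->
    `|complex.Re z| < r /\ `|complex.Im z| < r.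
  rewrite normc_def ltcR => zr; split; apply: le_lt_trans zr;
    by rewrite -sqrtr_sqr ler_wsqrtr// ?lerDl ?lerDr sqr_ge0.
have abs_ge (z : R[i]) (r : R) :
    `|complex.Re z| < r / 2 -> `|complex.Im z| < r / 2 -> `|z| < r%:C%C.
  case: z => c d /= cr dr; rewrite normc_def /= ltcR.
  apply: (@le_lt_trans _ _ (`|c| + `|d|)); last by rewrite (splitr r) ltrD.
  rewrite -[leRHS]ger0_norm ?addr_ge0// -sqrtr_sqr ler_wsqrtr//.
  rewrite sqrrD !real_normK ?num_real//.
  by rewrite addrAC lerDl mulrn_wge0// mulr_ge0.
have BRe (z w : R[i]) : complex.Re z - complex.Re w = complex.Re (z - w).
  by case: z => a b; case: w.
have BIm (z w : R[i]) : complex.Im z - complex.Im w = complex.Im (z - w).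
  by case: z => a b; case: w.
have Hre : cauchy (@complex.Re R @ F).
  apply/cauchy_exP => e e0.
  have [|z Fz] := Fc e%:C%C; first by rewrite ltcR.
  exists (complex.Re z); rewrite /fmap /=; apply: (filterS _ Fz) => w.
  move=> wz; suff: `|complex.Re (z - w)| < e by rewrite -BRe.
  exact: (abs_le _ _ wz).1.
have Him : cauchy (@complex.Im R @ F).
  apply/cauchy_exP => e e0.
  have [|z Fz] := Fc e%:C%C; first by rewrite ltcR.
  exists (complex.Im z); rewrite /fmap /=; apply: (filterS _ Fz) => w.
  move=> wz; suff: `|complex.Im (z - w)| < e by rewrite -BIm.
  exact: (abs_le _ _ wz).2.
have [a Fa] : exists r : R, @complex.Re R @ F --> r.
  by apply/cvg_ex; exact: R_complete.
have [b Fb] : exists r : R, @complex.Im R @ F --> r.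
  by apply/cvg_ex; exact: R_complete.
apply/cvg_ex; exists (Complex a b).
apply/cvgrPdist_lt => e e0.
have [r r0 ->] := @pos_of_real R ComplexScalars e e0.
have r20 : 0 < r / 2 by rewrite divr_gt0.
move/cvgrPdist_lt/(_ _ r20) : Fa => Fa.
move/cvgrPdist_lt/(_ _ r20) : Fb => Fb.
near=> z.
have za : `|a - complex.Re z| < r / 2 by near: z.
have zb : `|b - complex.Im z| < r / 2 by near: z.
by apply: abs_ge; rewrite -?BRe -?BIm.
Unshelve. all: by end_near. Qed.

Lemma scalar_cauchy_cvg (R : realType) (k : scalar_kind)
  (F : set_system (scalar_field R k)) : ProperFilter F -> cauchy F -> cvg F.
Proof. case: k F => /= F; [exact: R_complete|exact: complex_cauchy_cvg]. Qed.

Lemma minkowski_sum (R : realType) (p : R) (n : nat) (f g : nat -> R) :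
  1 <= p -> (forall j, 0 <= f j) -> (forall j, 0 <= g j) ->
  (\sum_(j < n) (f j + g j) `^ p) `^ p^-1 <=
  (\sum_(j < n) f j `^ p) `^ p^-1 + (\sum_(j < n) g j `^ p) `^ p^-1.
Proof.
move=> p1 f0 g0; have p0 : 0 < p by rewrite (lt_le_trans _ p1).
pose tr (h : nat -> R) j : R := if (j < n)%N then h j else 0.
have trE h : (forall j, 0 <= h j) -> Lnorm counting p%:E (EFin \o tr h) =
    ((\sum_(j < n) h j `^ p) `^ p^-1)%:E.
  move=> h0; rewrite Lnorm_counting// (nneseries_split 0 n); last first.
    by move=> j _; exact: poweR_ge0.
  rewrite add0n ereal_series_cond eseries0 ?adde0; last first.
    move=> j _ /andP[nj _].
    have -> : (EFin \o tr h) j = 0%E by rewrite /= /tr ltnNge nj.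
    by rewrite abse0 poweR0r// gt_eqF.
  rewrite big_mkord -poweR_EFin -sumEFin; congr (_ `^ _)%E.
  by apply: eq_bigr => j _; rewrite /= /tr ltn_ord ger0_norm.
have mtr h : measurable_fun [set: nat] (tr h) by [].
have := minkowski_EFin counting (mtr f) (mtr g) p1.
have -> : tr f \+ tr g = tr (fun j => f j + g j).
  by apply/funext => j /=; rewrite /tr; case: ifP; rewrite ?addr0.
rewrite (trE f)// (trE g)// (trE (fun j => f j + g j)); last first.
  by move=> j; rewrite addr_ge0.
by rewrite -EFinD lee_fin.
Qed.

(* Up to order isomorphism, the set [0, omega_1) of countable ordinals is the
   only uncountable well-ordered set all of whose proper initial segments are
   countable; an [orderTopologicalType] carries the order topology. *)
Record omega1 (d : Order.disp_t) := Omega1 {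
  omega1_sort :> orderTopologicalType d;
  omega1_well_ordered : forall A : set omega1_sort, A !=set0 ->
    exists2 a, A a & forall b, A b -> (a <= b)%O;
  omega1_countable_segment : forall a : omega1_sort,
    countable [set b : omega1_sort | (b < a)%O];
  omega1_uncountable : ~ countable [set: omega1_sort]
}.

Section JamesSpace.
Context (R : realType) (k : scalar_kind) (d : Order.disp_t) (W : omega1 d).
Notation K := (scalar_field R k).
Implicit Types (x y : W -> K^o) (a : nat -> W) (n : nat).

(* The filter of neighbourhoods of omega_1 in [0, omega_1). *)
Definition to_omega1 : set_system W :=
  filter_from [set: W] (fun b => [set c | (b <= c)%O]).

(* Only the values a 0 < ... < a n matter. *)
Definition increasing_upto n a := forall j, (j < n)%N -> (a j < a j.+1)%O.

Definition p_variation (p : R) x n a : R :=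
  (\sum_(j < n) modulus (x (a j.+1) - x (a j)) `^ p) `^ p^-1.

Definition norm_p0 (p : R) x : \bar R :=
  ereal_sup [set (p_variation p x na.1 na.2)%:E |
             na in [set na | increasing_upto na.1 na.2]].

Definition in_james_space (p : R) x : Prop :=
  [/\ continuous x, x @ to_omega1 --> 0 & (norm_p0 p x < +oo)%E].

Lemma omega1_inhabited : exists a : W, True.
Proof.
apply: contrapT => W0; apply: (@omega1_uncountable _ W).
suff -> : [set: W] = set0 by exact: countable0.
by rewrite -subset0 => a _; apply: W0; exists a.
Qed.

#[local] Instance to_omega1_filter : ProperFilter to_omega1.
Proof.
have [a0 _] := omega1_inhabited.
apply: filter_from_proper; last by move=> a _; exists a => /=.
apply: filter_from_filter; first by exists a0.
move=> a b _ _; exists (Order.max a b) => // c /=.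
by rewrite ge_max => /andP.
Qed.

Section Variation.
Context (p : R) (p1 : 1 < p).
Let p_ge1 : 1 <= p := ltW p1.
Let p_gt0 : 0 < p := lt_le_trans ltr01 p_ge1.

Lemma p_variation_ge0 x n a : 0 <= p_variation p x n a.
Proof. exact: powR_ge0. Qed.

Lemma p_variationD x y n a :
  p_variation p (x + y) n a <= p_variation p x n a + p_variation p y n a.
Proof.
have mod0 (z : W -> K^o) j : 0 <= modulus (z (a j.+1) - z (a j)).
  exact: modulus_ge0.
apply: le_trans (minkowski_sum n p_ge1 (mod0 x) (mod0 y)).
apply: ge0_ler_powR; rewrite ?nnegrE ?invr_ge0 ?(ltW p_gt0)//.
- by apply: sumr_ge0 => j _; exact: powR_ge0.
- by apply: sumr_ge0 => j _; exact: powR_ge0.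
apply: ler_sum => j _; apply: ge0_ler_powR;
  rewrite ?nnegrE ?addr_ge0 ?modulus_ge0 ?(ltW p_gt0)//.
by rewrite (le_trans _ (modulusD _ _))//= opprD addrACA.
Qed.

Lemma p_variationZ (c : K) x n a :
  p_variation p (c *: x) n a = modulus c * p_variation p x n a.
Proof.
rewrite /p_variation; under eq_bigr => j _.
  rewrite [_ - _](_ : _ = c * (x (a j.+1) - x (a j))); last by rewrite mulrBr.
  rewrite modulusM powRM ?modulus_ge0//; over.
rewrite -mulr_sumr powRM ?powR_ge0//; last first.
  by apply: sumr_ge0 => j _; exact: powR_ge0.
by rewrite -powRrM mulfV ?gt_eqF// powRr1 ?modulus_ge0.
Qed.

Lemma p_variation_le_norm x n a : increasing_upto n a ->
  (norm_p0 p x < +oo)%E -> p_variation p x n a <= fine (norm_p0 p x).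
Proof.
move=> na xoo; have xn : ((p_variation p x n a)%:E <= norm_p0 p x)%E.
  by apply: ereal_sup_ubound; exists (n, a).
rewrite -lee_fin fineK// fin_numE; apply/andP; split; last by rewrite lt_eqF.
by rewrite gt_eqF// (lt_le_trans _ xn)// ltNye.
Qed.

Lemma norm_p0_le x (M : R) :
  (forall n a, increasing_upto n a -> p_variation p x n a <= M) ->
  (norm_p0 p x < +oo)%E /\ fine (norm_p0 p x) <= M.
Proof.
move=> xM; have xn : (norm_p0 p x <= M%:E)%E.
  by apply: ge_ereal_sup => _ [[n a] na <-]; rewrite lee_fin xM.
have x_lt : (norm_p0 p x < +oo)%E by rewrite (le_lt_trans xn)// ltry.
split=> //; have [a0 _] := omega1_inhabited.
have xn0 : ((p_variation p x 0 (fun=> a0))%:E <= norm_p0 p x)%E.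
  by apply: ereal_sup_ubound; exists (0%N, fun=> a0).
rewrite -lee_fin fineK// fin_numE; apply/andP; split; last by rewrite lt_eqF.
by rewrite gt_eqF// (lt_le_trans _ xn0)// ltNye.
Qed.

Lemma fine_norm_p0_ge0 x : (norm_p0 p x < +oo)%E -> 0 <= fine (norm_p0 p x).
Proof.
have [a0 _] := omega1_inhabited => xoo.
apply: le_trans (@p_variation_le_norm x 0 (fun=> a0) _ xoo) => //.
exact: p_variation_ge0.
Qed.

Lemma modulus_diff_le_norm x (b c : W) : (norm_p0 p x < +oo)%E ->
  modulus (x c - x b) <= fine (norm_p0 p x).
Proof.
wlog bc : b c / (b <= c)%O.
  move=> wl xoo; have [bc|/ltW cb] := leP b c; first exact: wl.
  by rewrite -modulusN opprB; exact: wl.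
move=> xoo; have [->|bc'] := eqVneq b c.
  by rewrite subrr modulus0 fine_norm_p0_ge0.
pose a j : W := if j is 0 then b else c.
have a1 : increasing_upto 1 a by case=> // _; rewrite /= lt_neqAle bc'.
have := p_variation_le_norm a1 xoo.
by rewrite /p_variation big_ord1/= -powRrM mulfV ?gt_eqF// powRr1 ?modulus_ge0.
Qed.

Lemma modulus_le_norm x (b : W) : in_james_space p x ->
  modulus (x b) <= fine (norm_p0 p x).
Proof.
move=> [_ x0 xoo]; apply/ler_addgt0Pr => e e0.
have e0' : 0 < of_real k e by rewrite -(of_real0 R k) lt_of_real.
move/cvgrPdist_lt/(_ _ e0') : x0 => [c _ cx].
have := cx (Order.max b c); rewrite /= le_max lexx orbT => /(_ isT).
rewrite sub0r normrN -of_real_modulus lt_of_real => xe.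
rewrite -(subrK (x (Order.max b c)) (x b)) (le_trans (modulusD _ _))//.
by rewrite lerD ?modulus_diff_le_norm// ltW.
Qed.

Lemma in_james_space0 : in_james_space p 0.
Proof.
split; [exact: cst_continuous|exact: cvg_cst|].
apply: (norm_p0_le (M := 0) _).1 => n a _; rewrite /p_variation.
rewrite big1 ?powR0 ?gt_eqF ?invr_gt0// => j _.
by rewrite subrr modulus0 powR0// gt_eqF.
Qed.

Lemma norm_p0D x y : (norm_p0 p x < +oo)%E -> (norm_p0 p y < +oo)%E ->
  (norm_p0 p (x + y)%R < +oo)%E /\
  fine (norm_p0 p (x + y)) <= fine (norm_p0 p x) + fine (norm_p0 p y).
Proof.
move=> xoo yoo; apply: norm_p0_le => n a na.
by rewrite (le_trans (p_variationD _ _ _ _))// lerD ?p_variation_le_norm.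
Qed.

Lemma norm_p0Z (c : K) x : (norm_p0 p x < +oo)%E ->
  (norm_p0 p (c *: x)%R < +oo)%E /\
  fine (norm_p0 p (c *: x)) = modulus c * fine (norm_p0 p x).
Proof.
have le_normZ b y : (norm_p0 p y < +oo)%E -> (norm_p0 p (b *: y)%R < +oo)%E /\
    fine (norm_p0 p (b *: y)) <= modulus b * fine (norm_p0 p y).
  move=> yoo; apply: norm_p0_le => n a na; rewrite p_variationZ.
  by rewrite ler_wpM2l ?modulus_ge0// p_variation_le_norm.
move=> xoo; have [cxoo cx] := le_normZ c x xoo; split=> //.
apply/eqP; rewrite eq_le cx /=; have [->|c0] := eqVneq c 0.
  rewrite (_ : modulus 0 * _ = 0); last by rewrite modulus0; exact: mul0r.
  by apply: fine_norm_p0_ge0; exact: (le_normZ 0 x xoo).1.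
have c_gt0 : 0 < modulus c.
  by rewrite lt0r modulus_ge0 andbT; apply: contra c0 => /eqP/modulus0_eq0 ->.
have [_] := le_normZ c^-1 _ cxoo; rewrite scalerA mulVf// scale1r.
rewrite -(ler_pM2l c_gt0) mulrA -modulusM mulfV// => /le_trans; apply.
suff -> : modulus (1 : K) = 1 by rewrite mul1r.
by apply: (@of_real_inj R k); rewrite of_real_modulus normr1; case: (k).
Qed.

Lemma in_james_spaceD x y :
  in_james_space p x -> in_james_space p y -> in_james_space p (x + y).
Proof.
move=> [cx x0 xoo] [cy y0 yoo]; split.
- by move=> b; apply: cvgD; [exact: cx|exact: cy].
- by rewrite -[0 : K^o]addr0; apply: cvgD.
- exact: (norm_p0D xoo yoo).1.
Qed.

Lemma in_james_spaceZ (c : K) x :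
  in_james_space p x -> in_james_space p (c *: x).
Proof.
move=> [cx x0 xoo]; split.
- by move=> b; apply: cvgZr; exact: cx.
- by rewrite -(scaler0 _ c); apply: cvgZr.
- exact: (norm_p0Z c xoo).1.
Qed.

Lemma norm_p0_eq0 x : in_james_space p x -> fine (norm_p0 p x) = 0 -> x = 0.
Proof.
move=> Jx x0; apply/funext => b; apply: modulus0_eq0; apply/eqP.
by rewrite eq_le modulus_ge0 andbT -x0 modulus_le_norm.
Qed.

End Variation.

Section Space.
Context (p : R) (p1 : 1 < p).

Definition james_pred : {pred W -> K^o} := mem [set x | in_james_space p x].

(* [lt1p] is a parameter because the structures below need [1 < p]. *)
Record james_space (lt1p : 1 < p) := JamesSpace {
  james_fun :> W -> K^o;
  james_funP : james_fun \in james_pred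
}.
HB.instance Definition _ := [isSub for @james_fun p1].
HB.instance Definition _ := [Choice of james_space p1 by <:].

Lemma james_submod_closed : submod_closed james_pred.
Proof.
split=> [|c x y /set_mem Jx /set_mem Jy].
  by refine (mem_set _ : _ \in [set x | in_james_space p x]);
    exact: in_james_space0.
refine (mem_set _ : _ \in [set x | in_james_space p x]).
exact (in_james_spaceD p1 (in_james_spaceZ p1 c Jx) Jy).
Qed.
HB.instance Definition _ :=
  GRing.isSubmodClosed.Build _ _ james_pred james_submod_closed.
HB.instance Definition _ :=
  [SubChoice_isSubLmodule of james_space p1 by <:].


Implicit Types u v : james_space p1.

Definition james_norm u : K := of_real k (fine (norm_p0 p u)).

Lemma james_spaceP u : in_james_space p u.
Proof. exact: set_mem (james_funP u). Qed.

Let james_fin u : (norm_p0 p u < +oo)%E.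
Proof. by have [] := james_spaceP u. Qed.

Lemma james_normD u v : james_norm (u + v) <= james_norm u + james_norm v.
Proof.
by rewrite -of_realD le_of_real; exact: (norm_p0D p1 (james_fin u) (james_fin v)).2.
Qed.

Lemma james_normZ (c : K) u : james_norm (c *: u) = `|c| * james_norm u.
Proof.
rewrite -of_real_modulus -of_realM; congr of_real.
exact: (norm_p0Z p1 c (james_fin u)).2.
Qed.

Lemma james_norm0_eq0 u : james_norm u = 0 -> u = 0.
Proof.
rewrite -(of_real0 R k) => /of_real_inj u0; apply: val_inj.
exact: (norm_p0_eq0 p1 (james_spaceP u) u0).
Qed.

HB.instance Definition _ := Lmodule_isNormed.Build K (james_space p1)
  james_normD james_normZ james_norm0_eq0.

Lemma james_normE u : `|u| = of_real k (fine (norm_p0 p u)).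
Proof. by []. Qed.

Lemma modulus_james u b : `|u b| <= `|u|.
Proof.
rewrite james_normE -of_real_modulus le_of_real.
exact: modulus_le_norm (james_spaceP u).
Qed.

Lemma p_variation_le_sup x n a (e : R) : 0 <= e ->
  (forall j, (j < n)%N -> modulus (x (a j.+1) - x (a j)) <= e) ->
  p_variation p x n a <= n%:R `^ p^-1 * e.
Proof.
have p0 : 0 < p by rewrite (lt_trans _ p1).
move=> e0 xe; have eE : e = (e `^ p) `^ p^-1.
  by rewrite -powRrM mulfV ?powRr1// gt_eqF.
rewrite [in leRHS]eE -powRM ?powR_ge0//.
apply: ge0_ler_powR; rewrite ?nnegrE ?mulr_ge0 ?invr_ge0 ?powR_ge0 ?(ltW p0)//.
  by apply: sumr_ge0 => j _; exact: powR_ge0.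
apply: (@le_trans _ _ (\sum_(j < n) e `^ p)).
  apply: ler_sum => j _; apply: ge0_ler_powR;
    by rewrite ?nnegrE ?modulus_ge0 ?(ltW p0)// xe.
by rewrite sumr_const card_ord mulr_natl.
Qed.

Lemma james_cauchy_cvg (F : set_system (james_space p1)) :
  ProperFilter F -> cauchy F -> cvg F.
Proof.
move=> FF /cauchyP Fc.
have of_real_gt0 (e : R) : 0 < e -> 0 < of_real k e.
  by rewrite -(of_real0 R k) lt_of_real.
have Fev b : cvg ((fun u => u b : K) @ F).
  apply: scalar_cauchy_cvg; apply/cauchy_exP => e /Fc[u Fu].
  exists (u b); rewrite /fmap /=; apply: (filterS _ Fu) => v.
  rewrite -!ball_normE /ball_ /=; apply: le_lt_trans.
  exact: (modulus_james (u - v) b).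
pose l b : K^o := lim ((fun u => u b : K) @ F).
have Fl b : (fun u => u b : K) @ F --> (l b : K) by exact: Fev.
have Fclose (e t : R) (u : james_space p1) (a : nat -> W) n :
    F (ball u (of_real k e)) -> 0 < t ->
    exists2 v : james_space p1, ball u (of_real k e) v &
      forall j, (j <= n)%N -> modulus (l (a j) - v (a j)) < t.
  move=> Fu t0.
  have Ft j : F [set v : james_space p1 | modulus (l (a j) - v (a j)) < t].
    have /cvgrPdist_lt/(_ _ (of_real_gt0 _ t0)) := Fl (a j).
    by apply: filterS => v; rewrite -of_real_modulus lt_of_real.
  have Fn : F [set v : james_space p1 |
      forall j, (j <= n)%N -> modulus (l (a j) - v (a j)) < t].
    elim: n => [|n IHn]; first by apply: filterS (Ft 0%N) => v vt [].
    apply: filterS2 IHn (Ft n.+1) => v vn vn1 j.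
    by rewrite leq_eqVlt => /predU1P[->//|]; exact: vn.
  by have [v [? ?]] := filter_ex (filterI Fu Fn); exists v.
have ball_fine (e : R) (u v : james_space p1) : ball u (of_real k e) v ->
    fine (norm_p0 p (v - u)) < e.
  by rewrite -ball_normE /= distrC james_normE lt_of_real.
have Fapprox (e : R) : 0 < e -> exists u : james_space p1,
    [/\ F (ball u (of_real k e)),
        (norm_p0 p (l - (u : W -> K^o)%R)%R < +oo)%E,
        fine (norm_p0 p (l - (u : W -> K^o))) <= e &
        forall b, modulus (l b - u b) <= e].
  move=> e0; have [|u Fu] := Fc (of_real k e); first exact: of_real_gt0.
  have lu b : modulus (l b - u b) <= e.
    apply/ler_addgt0Pr => t t0.
    have [v vu /(_ 0%N isT) vl] := Fclose e t u (fun=> b) 0%N Fu t0.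
    rewrite -(subrK (v b) (l b)) -addrA (le_trans (modulusD _ _))//.
    rewrite [e + t]addrC lerD// ?(ltW vl)//; apply: le_trans (ltW (ball_fine _ _ _ vu)).
    by rewrite -(le_of_real k) of_real_modulus; exact: (modulus_james (v - u) b).
  exists u; suff [] : (norm_p0 p (l - (u : W -> K^o)%R)%R < +oo)%E /\
    fine (norm_p0 p (l - (u : W -> K^o))) <= e by [].
  apply: norm_p0_le => n a na.
  apply/ler_addgt0Pr => t t0.
  pose N : R := n%:R `^ p^-1 + 1.
  have N0 : 0 < N by rewrite ltr_pwDr ?powR_ge0.
  have t'0 : 0 < t / N / 2 by rewrite !divr_gt0.
  have [v vu vl] := Fclose e _ u a n Fu t'0.
  rewrite (_ : l - _ = (l - (v : W -> K^o)) + ((v - u : james_space p1) : W -> K^o));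
    last by rewrite /= addrA subrK.
  rewrite (le_trans (p_variationD p1 _ _ _ _))// [e + t]addrC lerD//; last first.
    apply: le_trans (ltW (ball_fine _ _ _ vu)).
    exact: p_variation_le_norm (james_fin _).
  apply: (@le_trans _ _ (n%:R `^ p^-1 * (t / N))).
    apply: p_variation_le_sup; first by rewrite ltW// divr_gt0.
    move=> j jn; rewrite (le_trans (modulusD _ _))// modulusN.
    rewrite [leRHS]splitr lerD// ltW//; [exact: vl|exact: vl (ltnW _)].
  rewrite mulrCA ger_pMr// ler_pdivrMr// mul1r /N lerDl ler01//.
have Jl : in_james_space p l.
  split.
  - move=> b; apply/cvgrPdist_lt => _ /pos_of_real[e e0 ->].
    have e3 : 0 < e / 3 by rewrite divr_gt0.
    have [u [_ _ _ ul]] := Fapprox _ e3.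
    have [uc _ _] := james_spaceP u.
    have /cvgrPdist_lt/(_ _ (of_real_gt0 _ e3)) := uc b.
    apply: filterS => c; rewrite -!of_real_modulus !lt_of_real => ubc.
    have -> : l b - l c = (l b - u b) + (u b - u c) + - (l c - u c).
      by rewrite subrKA opprB subrKA.
    apply: le_lt_trans (modulusD _ _) _; rewrite modulusN.
    have := modulusD (l b - u b) (u b - u c); have := ul b; have := ul c.
    by lra.
  - apply/cvgrPdist_lt => _ /pos_of_real[e e0 ->].
    have e2 : 0 < e / 2 by rewrite divr_gt0.
    have [u [_ _ _ ul]] := Fapprox _ e2.
    have [_ u0 _] := james_spaceP u.
    move/cvgrPdist_lt/(_ _ (of_real_gt0 _ e2)) : u0.
    apply: filterS => c; rewrite -!of_real_modulus !lt_of_real !sub0r !modulusN.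
    move=> uc; rewrite -(subrK (u c) (l c)).
    apply: le_lt_trans (modulusD _ _) _.
    by rewrite (splitr e) ler_ltD.
  - have [u [_ loo _ _]] := Fapprox 1 ltr01.
    rewrite -(subrK (u : W -> K^o) l).
    exact: (norm_p0D p1 loo (james_fin u)).1.
pose L : james_space p1 := JamesSpace p1 (mem_set Jl).
apply/cvg_ex; exists L; apply/cvgrPdist_lt => _ /pos_of_real[e e0 ->].
have e20 : 0 < e / 2 by rewrite divr_gt0.
have [u [Fu _ lu _]] := Fapprox _ e20.
have Lu : `|L - u| <= of_real k (e / 2).
  by rewrite james_normE le_of_real; exact lu.
apply: filterS Fu => v; rewrite -ball_normE => uv.
rewrite -(subrK u L) -addrA (le_lt_trans (ler_normD _ _))//.
by rewrite (splitr e) of_realD; exact: ler_ltD Lu uv.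
Qed.
HB.instance Definition _ :=
  Uniform_isComplete.Build (james_space p1) james_cauchy_cvg.

End Space.
End JamesSpace.

Section BoundedOperators.
Context (K : numFieldType).

Definition bounded_linear (X Y : normedModType K) (f : X -> Y) : Prop :=
  linear f /\ exists M : K, forall x, `|f x| <= M * `|x|.

Definition bounded_linear_pred (X Y : normedModType K) : {pred X -> Y} :=
  mem [set f : X -> Y | bounded_linear f].

Section Module.
Context (X Y : normedModType K).

Record bounded_op := BoundedOp {
  bounded_op_fun :> X -> Y;
  bounded_op_in : bounded_op_fun \in @bounded_linear_pred X Y
}.
HB.instance Definition _ := [isSub for bounded_op_fun].
HB.instance Definition _ := [Choice of bounded_op by <:].

Lemma bounded_linear_submod_closed : submod_closed (@bounded_linear_pred X Y).
Proof.
split.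
  rewrite inE; split; first by move=> c x y /=; rewrite scaler0 addr0.
  by exists 0 => x; rewrite mul0r normr0.
move=> c f g; rewrite !inE => -[lf [M fM]] [lg [N gN]]; split.
  move=> b x y /=; rewrite !fctE lf lg !scalerDr !scalerA (mulrC c).
  by rewrite addrACA.
exists (`|c| * M + N) => x; rewrite !fctE (le_trans (ler_normD _ _))// mulrDl.
by rewrite lerD// normrZ -mulrA ler_wpM2l.
Qed.
HB.instance Definition _ := GRing.isSubmodClosed.Build K _
  (@bounded_linear_pred X Y) bounded_linear_submod_closed.
HB.instance Definition _ := [SubChoice_isSubLmodule of bounded_op by <:].

Lemma bounded_opP (f : bounded_op) : bounded_linear f.
Proof. by case: f => f /=; rewrite inE. Qed.

HB.instance Definition _ (f : bounded_op) :=
  GRing.isLinear.Build K X Y *:%R f (bounded_opP f).1.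

End Module.

Section Ring.
Context (X : normedModType K).
Implicit Types f g h : bounded_op X X.

Lemma bounded_op_id_subproof : idfun \in @bounded_linear_pred X X.
Proof. by rewrite inE; split=> //; exists 1 => x; rewrite mul1r. Qed.
Definition bounded_op_id : bounded_op X X := BoundedOp bounded_op_id_subproof.

Lemma bounded_op_comp_subproof f g : f \o g \in @bounded_linear_pred X X.
Proof.
have [lf [M fM]] := bounded_opP f; have [lg [N gN]] := bounded_opP g.
rewrite inE; split; first by move=> c x y /=; rewrite lg lf.
exists (`|M| * N) => x; rewrite (le_trans (fM _))// -mulrA.
apply: (@le_trans _ _ (`|M| * `|g x|)); last by rewrite ler_wpM2l.
have [->|gx0] := eqVneq (g x) 0; first by rewrite normr0 !mulr0.
have M_ge0 : 0 <= M.
  have gx_gt0 : 0 < `|g x| by rewrite normr_gt0.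
  by rewrite -(pmulr_lge0 _ gx_gt0) (le_trans _ (fM _)).
by rewrite ger0_norm.
Qed.
Definition bounded_op_comp f g : bounded_op X X :=
  BoundedOp (bounded_op_comp_subproof f g).

Lemma bounded_op_compA : associative bounded_op_comp.
Proof. by move=> f g h; apply: val_inj. Qed.
Lemma bounded_op_comp1f : left_id bounded_op_id bounded_op_comp.
Proof. by move=> f; apply: val_inj. Qed.
Lemma bounded_op_compf1 : right_id bounded_op_id bounded_op_comp.
Proof. by move=> f; apply: val_inj. Qed.
Lemma bounded_op_compDl : left_distributive bounded_op_comp +%R.
Proof. by move=> f g h; apply: val_inj. Qed.
Lemma bounded_op_compDr : right_distributive bounded_op_comp +%R.
Proof.
by move=> f g h; apply: val_inj; apply/funext => x /=; rewrite !fctE raddfD.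
Qed.
HB.instance Definition _ := GRing.Zmodule_isPzRing.Build (bounded_op X X)
  bounded_op_compA bounded_op_comp1f bounded_op_compf1
  bounded_op_compDl bounded_op_compDr.

End Ring.

Definition dual (X : normedModType K) := bounded_op X K^o.

(* The coarsest topology on X for which every bounded linear functional is
   continuous. *)
Definition weak (X : normedModType K) : Type :=
  sup_topology (fun f : dual X =>
    Topological.class (initial_topology (f : X -> K^o))).
HB.instance Definition _ (X : normedModType K) := Topological.on (weak X).

Definition weakly_compact (X : normedModType K) (A : set X) : Prop :=
  compact (A : set (weak X)).

Definition linear_span (X : normedModType K) (A : set X) : set X :=
  [set x | exists n (c : 'I_n -> K) (a : 'I_n -> X),
    (forall i, A (a i)) /\ x = \sum_(i < n) c i *: a i].

Definition WCG (X : completeNormedModType K) : Prop :=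
  exists A : set X, weakly_compact A /\ dense (linear_span A).

Record closed_subspace (X : normedModType K) := ClosedSubspace {
  subspace_set :> set X;
  subspace_submod : submod_closed (mem subspace_set : {pred X});
  subspace_closed : closed subspace_set
}.

Definition subspace_pred (X : normedModType K) (Y : closed_subspace X) :
  {pred X} := mem (subspace_set Y).

Section SubspaceType.
Context (X : normedModType K) (Y : closed_subspace X).

Record subspace_type := SubspaceElement {
  subspace_val :> X;
  subspace_valP : subspace_val \in subspace_pred Y
}.
HB.instance Definition _ := [isSub for subspace_val].
HB.instance Definition _ := [Choice of subspace_type by <:].
HB.instance Definition _ :=
  GRing.isSubmodClosed.Build K X (subspace_pred Y) (subspace_submod Y).
HB.instance Definition _ := [SubChoice_isSubLmodule of subspace_type by <:].

Definition subspace_norm (u : subspace_type) : K := `|subspace_val u|.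

Lemma subspace_normD u v :
  subspace_norm (u + v) <= subspace_norm u + subspace_norm v.
Proof. exact: ler_normD. Qed.
Lemma subspace_normZ (c : K) u :
  subspace_norm (c *: u) = `|c| * subspace_norm u.
Proof. exact: normrZ. Qed.
Lemma subspace_norm0_eq0 u : subspace_norm u = 0 -> u = 0.
Proof. by move=> /normr0_eq0 u0; apply: val_inj. Qed.
HB.instance Definition _ := Lmodule_isNormed.Build K subspace_type
  subspace_normD subspace_normZ subspace_norm0_eq0.

End SubspaceType.

Section SubspaceComplete.
Context (X : completeNormedModType K) (Y : closed_subspace X).

Lemma subspace_cauchy_cvg (F : set_system (subspace_type Y)) :
  ProperFilter F -> cauchy F -> cvg F.
Proof.
move=> FF /cauchyP Fc; pose i := @subspace_val X Y.
have Fi : cvg (i @ F).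
  apply: cauchy_cvg; apply/cauchy_exP => e /Fc[u Fu].
  by exists (i u); rewrite /fmap /=; apply: (filterS _ Fu) => v;
    rewrite -!ball_normE.
have Yl : subspace_set Y (lim (i @ F)).
  have FY : \forall u \near F, subspace_set Y (i u).
    by apply: nearW => u; exact: set_mem (subspace_valP u).
  exact: (@closed_cvg _ _ F FF i _ (@subspace_closed _ Y) FY _ Fi).
apply/cvg_ex; exists (SubspaceElement (mem_set Yl : _ \in subspace_pred Y)).
apply/cvgrPdist_lt => e e0.
by move/cvgrPdist_lt/(_ _ e0) : Fi; apply: filterS.
Qed.
HB.instance Definition _ :=
  Uniform_isComplete.Build (subspace_type Y) subspace_cauchy_cvg.

End SubspaceComplete.

Definition WCG_operators (X : completeNormedModType K) :
    set (bounded_op X X) :=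
  [set T | exists Y : closed_subspace X,
    WCG (subspace_type Y) /\ range T `<=` Y].

End BoundedOperators.

Definition commutator (A : pzRingType) (x : A) : Prop :=
  exists a b : A, x = a * b - b * a.

(* Main.v *)
(* If A is a weakly compact set generating the subspace, then for every b and
   e > 0 there is c such that no element of A stays above e on (b, c]: a weak
   cluster point of counterexamples would not vanish at omega_1.  Hence every
   element of A, and then every T x, vanishes on a closed unbounded set D.  Let
   r c be the least element of D above c, so that P x = x - x o r is a projection
   with P T = T.  The p-variation of a function vanishing on D is, up to
   constants, the l_p-sum of its variations over the blocks between consecutive
   points of D.  Ordering the triples (r c, i, c), with i a natural number,
   lexicographically gives a well-ordered set isomorphic to omega_1, which
   provides infinitely many disjoint copies of these blocks.  With L_n reading
   the n-th copy, R_n writing into it, S = sum_n R_n T L_n and the shifts V and U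
   of the copies (up and down),
     T = [P, T - T P] + [L_0, R_0 T P] + [S U, V],
   since S U V = S and S - V S U = R_0 T L_0. *)

Require Import Defs.
From mathcomp Require Import all_boot all_order all_algebra.
From mathcomp Require Import all_classical all_reals all_analysis.

Set Implicit Arguments.
Unset Strict Implicit.
Unset Printing Implicit Defensive.

Import Order.TTheory GRing.Theory Num.Theory.
Import numFieldNormedType.Exports.

Local Open Scope classical_set_scope.
Local Open Scope ring_scope.

(** * Countable ordinals: bounds, successors and neighbourhoods *)

Section CountableOrdinals.
Context (d : Order.disp_t) (W : omega1 d).
Implicit Types (a b c : W) (A : set W).

Lemma omega1_lt_wf : well_founded (fun a b : W => (a < b)%O).
Proof.
move=> a; apply: contrapT => na.
have [|b nb bmin] := @omega1_well_ordered _ W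
    [set b | ~ Acc (fun a b : W => (a < b)%O) b].
  by exists a.
apply: nb; constructor => c cb; apply: contrapT => nc.
by have := bmin c nc; rewrite leNgt cb.
Qed.

Lemma omega1_countable_le a : countable [set b : W | (b <= a)%O].
Proof.
apply: (@sub_countable _ _ _ (\bigcup_(t in [set: bool])
    (if t then [set b | (b < a)%O] else [set a]))).
  apply: subset_card_le => b /=; rewrite le_eqVlt => /predU1P[->|ba].
    by exists false.
  by exists true.
apply: bigcup_countable => //= -[] _; last exact: countable1.
exact: omega1_countable_segment.
Qed.

(** Otherwise the countable segments below the points of [A] would cover the uncountable [W]. *)
Lemma omega1_ubound A : countable A -> exists b, forall a, A a -> (a < b)%O.
Proof.
move=> cA; apply: contrapT => nb; apply: (@omega1_uncountable _ W).
apply: (@sub_countable _ _ _ (\bigcup_(a in A) [set b : W | (b <= a)%O])); last first.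
  by apply: bigcup_countable => // a _; exact: omega1_countable_le.
apply: subset_card_le => b _; apply: contrapT => nAb; apply: nb; exists b => a Aa.
by rewrite ltNge; apply/negP => ba; apply: nAb; exists a.
Qed.

Lemma omega1_succ a : exists2 b, (a < b)%O & forall c, (c < b)%O -> (c <= a)%O.
Proof.
have [b ab] := omega1_ubound (countable1 a).
have [|s /= as_ smin] := @omega1_well_ordered _ W [set c | (a < c)%O].
  by exists b; exact: ab.
exists s => // c cs; rewrite leNgt; apply/negP => /smin.
by rewrite leNgt cs.
Qed.

Lemma omega1_min : exists a, forall b, (a <= b)%O.
Proof.
have [a0 _] := omega1_inhabited W.
have [|a _ amin] := @omega1_well_ordered _ W setT; first by exists a0.
by exists a => b; exact: amin.
Qed.

(** With [s] the immediate successor of [b], the interval []v, s[] has no points to the right of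
    [b], so only the left side matters. *)
Lemma omega1_nbhsP b (P : W -> Prop) :
  P b -> ((exists v, (v < b)%O) -> exists2 v, (v < b)%O &
    forall c, (v < c)%O -> (c < b)%O -> P c) -> nbhs b P.
Proof.
move=> Pb Pl; have [s bs smin] := omega1_succ b.
have Pc c : (c < s)%O -> (c < b -> P c)%O -> P c.
  move=> /smin; rewrite le_eqVlt => /predU1P[->//|cb]; exact.
have [/Pl[v vb vP]|nv] := pselect (exists v, (v < b)%O).
- rewrite itv_nbhsE; exists `]v, s[%O.
    by split=> //; rewrite in_itv/= vb bs.
  move=> c; rewrite /= in_itv /= => /andP[vc cs].
  by apply: Pc => // cb; exact: vP.
- rewrite itv_nbhsE; exists `]-oo, s[%O; first by split=> //; rewrite in_itv.
  move=> c; rewrite /= in_itv /= => cs; apply: Pc => // cb.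
  by case: nv; exists c.
Qed.

Lemma nbhs_omega1_left b (P : W -> Prop) v0 : (v0 < b)%O ->
  nbhs b P -> exists2 v, (v0 <= v < b)%O &
    forall c, (v < c)%O -> (c <= b)%O -> P c.
Proof.
move=> vb; rewrite itv_nbhsE => -[i [] + bi iP].
case: i bi iP => [[[] l|[]] [[] u|[]]] //= + + oi; rewrite ?in_itv /= => bi iP.
- case/andP: bi => lb bu; exists (Order.max v0 l).
    by rewrite le_max lexx /= gt_max vb lb.
  move=> c; rewrite gt_max => /andP[_ lc] cb; apply: iP.
  by rewrite /= in_itv /= lc (le_lt_trans cb).
- exists (Order.max v0 l).
    by rewrite le_max lexx /= gt_max vb; case/andP: bi => ->.
  move=> c; rewrite gt_max => /andP[_ lc] cb; apply: iP.
  by rewrite /= in_itv /= lc.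
- exists v0; first by rewrite lexx vb.
  move=> c _ cb; apply: iP.
  by rewrite /= in_itv /= (le_lt_trans cb).
- exists v0; first by rewrite lexx vb.
  by move=> c _ cb; apply: iP; rewrite /= in_itv.
Qed.

End CountableOrdinals.

(** * Sums of increments over disjoint intervals *)

Section Variation.
Context (R : realType) (k : scalar_kind) (d : Order.disp_t) (W : omega1 d).
Context (p : R) (p1 : 1 < p).
Notation K := (scalar_field R k).
Implicit Types (f y : W -> K^o) (a b c v w : W).

Let p_gt0 : 0 < p. Proof. exact: lt_trans ltr01 p1. Qed.

Definition increment f a b : R := modulus (f b - f a) `^ p.

Local Notation norm f := (fine (norm_p0 p f)).

Lemma increment_ge0 f a b : 0 <= increment f a b.
Proof. exact: powR_ge0. Qed.

Lemma incrementxx f a : increment f a a = 0.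
Proof. by rewrite /increment subrr modulus0 powR0// gt_eqF. Qed.

Lemma powRK (r : R) : 0 <= r -> (r `^ p^-1) `^ p = r.
Proof. by move=> r0; rewrite -powRrM mulVf ?powRr1// gt_eqF. Qed.

Lemma powRVK (r : R) : 0 <= r -> (r `^ p) `^ p^-1 = r.
Proof. by move=> r0; rewrite -powRrM mulfV ?powRr1// gt_eqF. Qed.

Lemma sum_increment_le f n (a : nat -> W) : (norm_p0 p f < +oo)%E ->
  increasing_upto n a -> \sum_(j < n) increment f (a j) (a j.+1) <= norm f `^ p.
Proof.
move=> foo /p_variation_le_norm -/(_ _ _ _ _ foo) fa.
have S0 : 0 <= \sum_(j < n) increment f (a j) (a j.+1).
  by apply: sumr_ge0 => j _; exact: increment_ge0.
rewrite -[leLHS]powRK//; apply: ge0_ler_powR => //; first exact: ltW.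
  by rewrite nnegrE powR_ge0.
by rewrite nnegrE fine_norm_p0_ge0.
Qed.

Lemma norm_p0_le_powR f (M : R) : 0 <= M ->
  (forall n (a : nat -> W), increasing_upto n a ->
     \sum_(j < n) increment f (a j) (a j.+1) <= M) ->
  (norm_p0 p f < +oo)%E /\ norm f `^ p <= M.
Proof.
move=> M0 fM; have [|foo fle] := @norm_p0_le R k d W p f (M `^ p^-1).
  move=> n a /fM SM; apply: ge0_ler_powR => //.
  - by rewrite invr_ge0 ltW.
  - by rewrite nnegrE; apply: sumr_ge0 => j _; exact: increment_ge0.
split=> //; rewrite -[leRHS]powRK//; apply: ge0_ler_powR => //; first exact: ltW.
  by rewrite nnegrE fine_norm_p0_ge0.
by rewrite nnegrE powR_ge0.
Qed.

Definition cons_chain a (s : nat -> W) j := if j is j'.+1 then s j' else a.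

Lemma increasing_cons_chain a s n :
  (a < s 0%N)%O -> increasing_upto n s -> increasing_upto n.+1 (cons_chain a s).
Proof. by move=> as0 sn [|j] //= jn; exact: sn. Qed.

Lemma sum_cons_chain f a s n :
  \sum_(j < n.+1) increment f (cons_chain a s j) (cons_chain a s j.+1) =
  increment f a (s 0%N) + \sum_(j < n) increment f (s j) (s j.+1).
Proof. by rewrite big_ord_recl. Qed.

(** Induction along the sorted list: gaps between intervals only add nonnegative increments. The
    start [v] varies because the chain for the tail has to begin at the end [b i] of the first
    interval. *)
Lemma chain_through_intervals f (I : eqType) (s : seq I) (a b : I -> W) v :
  uniq s -> sorted (fun i j => (a i <= a j)%O) s ->
  (forall i, i \in s -> (v <= a i)%O) ->
  (forall i, i \in s -> (a i < b i)%O) ->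
  (forall i j, i \in s -> j \in s -> i != j -> (b i <= a j \/ b j <= a i)%O) ->
  exists n (c : nat -> W), [/\ increasing_upto n c, c 0%N = v &
    \sum_(i <- s) increment f (a i) (b i) <=
    \sum_(j < n) increment f (c j) (c j.+1)].
Proof.
elim: s v => [|i s IH] v /=; first by move=> *; exists 0%N, (fun=> v);
  rewrite big_nil big_ord0.
move=> /andP[is_ us] pis vs ab ab'.
have ai : {in s, forall j, (a i <= a j)%O}.
  by apply/allP; apply: order_path_min pis => x y z; exact: le_trans.
have bi j : j \in s -> (b i <= a j)%O.
  move=> js; have ij : i != j by apply: contraNneq is_ => ->.
  have js' : j \in i :: s by rewrite inE js orbT.
  have [//|bj] := ab' i j (mem_head _ _) js' ij.
  by have := lt_le_trans (ab j js') (le_trans bj (ai j js)); rewrite ltxx.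
have [] := IH (b i) us (path_sorted pis) bi.
- by move=> j js; apply: ab; rewrite inE js orbT.
- by move=> j j' js js'; apply: ab'; rewrite inE ?js ?js' orbT.
move=> n [c [cn c0 cs]].
have abi := ab i (mem_head _ _); have vai := vs i (mem_head _ _).
have cn1 : increasing_upto n.+1 (cons_chain (a i) c).
  by apply: increasing_cons_chain => //; rewrite c0.
have sum1 : \sum_(j <- i :: s) increment f (a j) (b j) <=
    \sum_(j < n.+1) increment f (cons_chain (a i) c j) (cons_chain (a i) c j.+1).
  by rewrite big_cons sum_cons_chain c0 lerD2l.
(* Chains increase strictly, so [v] is prepended only when it differs from [a i]. *)
have [->|nv] := eqVneq v (a i); first by exists n.+1, (cons_chain (a i) c).
exists n.+2, (cons_chain v (cons_chain (a i) c)); split=> //.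
  by apply: increasing_cons_chain => //=; rewrite lt_neqAle nv.
by rewrite sum_cons_chain (le_trans sum1)// lerDr increment_ge0.
Qed.

(** Degenerate intervals contribute 0; the others, sorted by their left ends, fit into one chain. *)
Lemma sum_nonoverlap_le f (I : finType) (Q : pred I) (a b : I -> W) :
  (norm_p0 p f < +oo)%E -> (forall i, Q i -> (a i <= b i)%O) ->
  (forall i j, Q i -> Q j -> i != j -> (b i <= a j \/ b j <= a i)%O) ->
  \sum_(i | Q i) increment f (a i) (b i) <= norm f `^ p.
Proof.
move=> foo ab ab'.
pose s := sort (fun i j => (a i <= a j)%O) (enum [pred i | Q i & (a i < b i)%O]).
have sQ i : i \in s = Q i && (a i < b i)%O by rewrite mem_sort mem_enum.
have -> : \sum_(i | Q i) increment f (a i) (b i) =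
    \sum_(i <- s) increment f (a i) (b i).
  rewrite (bigID (fun i => (a i < b i)%O)) /= [X in _ + X]big1 ?addr0; last first.
    move=> i /andP[Qi]; rewrite -leNgt => ba.
    by rewrite (@le_anti _ _ (a i) (b i)) ?incrementxx// ab.
  rewrite (perm_big _ (permEl (perm_sort _ _))) big_enum.
  by apply: eq_bigl => i; rewrite inE.
have [v vmin] := omega1_min W.
have [||||i j|n [c [cn _ fc]]] := @chain_through_intervals f I s a b v.
- by rewrite sort_uniq enum_uniq.
- by apply: sort_sorted => i j; exact: le_total.
- by move=> i _; exact: vmin.
- by move=> i; rewrite sQ => /andP[].
- by rewrite !sQ => /andP[Qi _] /andP[Qj _]; exact: ab'.
exact: le_trans fc (sum_increment_le foo cn).
Qed.

Lemma modulusB_powR_le (z w : K) :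
  modulus (z - w) `^ p <= 2 `^ p * (modulus z `^ p + modulus w `^ p).
Proof.
wlog zw : z w / modulus w <= modulus z.
  move=> wl; have [|/ltW] := leP (modulus w) (modulus z); first exact: wl.
  by move=> /wl; rewrite -modulusN opprB [modulus w `^ p + _]addrC.
apply: (@le_trans _ _ ((2 * modulus z) `^ p)).
  apply: ge0_ler_powR; rewrite ?nnegrE ?mulr_ge0 ?modulus_ge0 ?(ltW p_gt0)//.
  rewrite (le_trans (modulusD _ _))// modulusN.
  by rewrite mulr_natl mulr2n lerD2l.
rewrite powRM ?modulus_ge0// ler_wpM2l ?powR_ge0// lerDl powR_ge0 //.
Qed.

(* A finite p-variation leaves no room for infinitely many disjoint oscillations
   of size at least e / 2. *)
Lemma cluster_eventually f (C : set W) (l : K) :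
  (norm_p0 p f < +oo)%E -> C !=set0 ->
  (forall v e, C v -> 0 < e -> 
    exists w, [/\ C w, (v < w)%O & modulus (f w - l) < e]) ->
  forall e, 0 < e -> exists2 v, C v &
    forall w, C w -> (v < w)%O -> modulus (f w - l) < e.
Proof.
move=> foo [v0 Cv0] fl e e0; apply: contrapT => nfl.
have e20 : 0 < e / 2 by rewrite divr_gt0.
have step v : exists ww : W * W, C v ->
    [/\ C ww.2, (v < ww.1)%O, (ww.1 < ww.2)%O &
      (e / 2) `^ p <= increment f ww.1 ww.2].
  have [Cv|] := pselect (C v); last by exists (v, v).
  have [w [Cw vw wl]] : exists w, [/\ C w, (v < w)%O & e <= modulus (f w - l)].
    apply: contrapT => nw; apply: nfl; exists v => // w Cw vw.
    by rewrite ltNge; apply/negP => ew; apply: nw; exists w.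
  have [w' [Cw' ww' w'l]] := fl w _ Cw e20.
  exists (w, w') => _; split=> //=; apply: ge0_ler_powR;
    rewrite ?nnegrE ?modulus_ge0 ?(ltW p_gt0) ?(ltW e20)//.
  have := modulusD (f w - f w') (f w' - l); rewrite addrA subrK.
  rewrite -(modulusN (f w - f w')) opprB => tri.
  have := le_trans wl tri; rewrite {1}(splitr e) => h.
  by rewrite -(lerD2r (modulus (f w' - l))) (le_trans _ h)// lerD2l ltW.
have [g gP] := choice step.
pose t := fix t n := if n is m.+1 then (g (t m)).2 else v0.
have Ct n : C (t n) by elim: n => //= n /gP[].
have tS n : (t n < (g (t n)).1)%O /\ ((g (t n)).1 < t n.+1)%O.
  by have [] := gP _ (Ct n).
have tlt n m : (n <= m)%N -> (t n <= t m)%O.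
  elim: m => [|m IH]; first by rewrite leqn0 => /eqP->.
  rewrite leq_eqVlt => /predU1P[->//|/IH tnm]; apply: le_trans tnm _.
  by have [h1 h2] := tS m; exact: ltW (lt_trans h1 h2).
have bnd n : n%:R * (e / 2) `^ p <= norm f `^ p.
  apply: le_trans _ (@sum_nonoverlap_le f 'I_n xpredT
    (fun i => (g (t i)).1) (fun i => (g (t i)).2) foo _ _).
  - rewrite mulr_natl -[X in _ *+ X]card_ord -sumr_const; apply: ler_sum => i _.
    by have [] := gP _ (Ct i).
  - by move=> i _; apply: ltW; have [] := gP _ (Ct i).
  - move=> i j _ _ ij.
    have [ij'|ji|/val_inj eij] := ltngtP i j; last by rewrite eij eqxx in ij.
      left; apply: le_trans (tlt i.+1 j ij') (ltW _); exact: (tS j).1.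
    right; apply: le_trans (tlt j.+1 i ji) (ltW _); exact: (tS i).1.
have c0 : 0 < (e / 2) `^ p by rewrite powR_gt0.
(* So many disjoint oscillations exceed the p-th power of the norm. *)
pose n := (Num.truncn (norm f `^ p / (e / 2) `^ p)).+1.
have := bnd n; rewrite -ler_pdivlMr// leNgt => /negP; apply.
exact: truncnS_gt.
Qed.

(** Since points have immediate successors, continuity is a matter of left limits; finite
    p-variation turns a cluster value from the left, or at omega_1, into a limit. *)
Lemma in_james_space_criterion f :
  (norm_p0 p f < +oo)%E ->
  (forall w, (forall v, (v < w)%O -> exists2 v', (v < v')%O & (v' < w)%O) ->
     forall v e, (v < w)%O -> 0 < e ->
       exists v', [/\ (v < v')%O, (v' < w)%O & modulus (f v' - f w) < e]) ->
  (forall v, exists2 v', (v < v')%O & f v' = 0) ->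
  in_james_space p f.
Proof.
move=> foo fleft fend; split=> //.
- move=> w; apply/cvgrPdist_lt => _ /pos_of_real[e e0 ->].
  apply: omega1_nbhsP => [|[v0 v0w]].
    by rewrite subrr normr0 -(of_real0 R k) lt_of_real.
  suff [v vw vP] : exists2 v, (v < w)%O & forall c, (v < c)%O -> (c < w)%O ->
      modulus (f c - f w) < e.
    exists v => // c vc cw; rewrite -of_real_modulus lt_of_real -modulusN opprB.
    exact: vP.
  have [wlim|] := pselect (forall v, (v < w)%O -> exists2 v', (v < v')%O & (v' < w)%O).
    have [|v t vw t0|v vw vP] :=
      @cluster_eventually f [set v | (v < w)%O] (f w) foo _ _ e e0.
    + by exists v0.
    + by have [v' [? ? ?]] := fleft w wlim v t vw t0; exists v'.
    + by exists v => // c vc cw; exact: vP.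
  (* A point that is not a limit has an empty interval to its left. *)
  move=> nlim; apply: contrapT => nv; apply: nlim => v vw; apply: contrapT => nv'.
  by apply: nv; exists v => // c vc cw; case: nv'; exists c.
- have FF := to_omega1_filter W.
  apply/cvgrPdist_lt => _ /pos_of_real[e e0 ->].
  have [v0 _] := omega1_inhabited W.
  have [|v t _ t0|v _ vP] := @cluster_eventually f setT 0 foo _ _ e e0.
  + by exists v0.
  + by have [v' vv' fv'] := fend v; exists v'; rewrite fv' subr0 modulus0.
  + have [s vs _] := omega1_succ v.
    exists s => // c /= sc; rewrite sub0r normrN -of_real_modulus lt_of_real.
    by have := vP c I (lt_le_trans vs sc); rewrite subr0.
Qed.

End Variation.

(** * Well-ordered sets isomorphic to omega_1 *)

Lemma countable_inj (T U : Type) (A : set T) (B : set U) (f : T -> U) :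
  {in A &, injective f} -> (forall x, A x -> B (f x)) ->
  countable B -> countable A.
Proof.
move=> finj fAB; apply: sub_countable; apply: (@card_le_trans _ _ _ (f @` A)).
  by have := card_esym (inj_card_eq finj); rewrite card_eq_le => /andP[].
by apply: subset_card_le => _ [x Ax <-]; exact: fAB.
Qed.

Section Enumeration.
Context (d : Order.disp_t) (W : omega1 d).

(** Strict suprema, with an arbitrary value on uncountable sets so that [lub] is total and can drive
    a recursion. *)
Lemma omega1_least_ubound : exists lub : set W -> W, forall A, countable A ->
  (forall a, A a -> (a < lub A)%O) /\
  forall b, (forall a, A a -> (a < b)%O) -> (lub A <= b)%O.
Proof.
suff /choice[lub lubP] : forall A : set W, exists m, countable A ->
    (forall a, A a -> (a < m)%O) /\
    forall b, (forall a, A a -> (a < b)%O) -> (m <= b)%O by exists lub.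
move=> A.
have [cA|nA] := pselect (countable A); last first.
  by have [a _] := omega1_inhabited W; exists a.
have [|m Am mmin] := @omega1_well_ordered _ W [set b | forall a, A a -> (a < b)%O].
  exact: omega1_ubound.
by exists m => _; split.
Qed.

(** The collapse: [H l] is the least point above all [H l'] with [l'] before [l]. If [w] were
    missed, all values would stay below [w] by induction, and the injective [H] would make [L]
    countable. *)
Lemma omega1_order_iso (L : Type) (lt : L -> L -> Prop) :
  well_founded lt -> (forall l l', [\/ lt l l', l = l' | lt l' l]) ->
  (forall l, countable [set l' | lt l' l]) -> ~ countable [set: L] ->
  exists H : L -> W, (forall l l', lt l l' -> (H l < H l')%O) /\
    forall w, exists l, H l = w.
Proof.
move=> wf tri seg unc; have [lub lubP] := omega1_least_ubound.
pose F l (rec : forall l', lt l' l -> W) := lub [set w | exists l' h, w = rec l' h].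
pose H := Fix wf _ F.
have HE l : H l = lub (H @` [set l' | lt l' l]).
  rewrite /H Fix_eq; last first.
    move=> {}l f g fg; congr F; apply: functional_extensionality_dep => l'.
    by apply: functional_extensionality_dep => h; exact: fg.
  congr lub; apply/seteqP; split => [w [l' [h ->]]|w [l' h <-]].
    by exists l'.
  by exists l', h.
have cH l : countable (H @` [set l' | lt l' l]).
  exact: sub_countable (card_image_le _ _) (seg l).
have Hlt l l' : lt l l' -> (H l < H l')%O.
  by move=> ll'; rewrite (HE l'); apply: (lubP _ (cH l')).1; exists l.
exists H; split=> // w; apply: contrapT => nw.
have [Hw|] := pselect (forall l, (H l < w)%O).
  apply: unc; apply: (@countable_inj _ _ _ _ H _ (fun l _ => Hw l)
    (@omega1_countable_segment _ W w)) => l l' _ _ HH.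
  by case: (tri l l') => // /Hlt; rewrite HH ltxx.
apply; elim/(well_founded_induction wf) => l IH.
rewrite lt_neqAle; apply/andP; split.
  by apply/eqP => Hl; apply: nw; exists l.
by rewrite HE; apply: (lubP _ (cH l)).2 => _ [l' /IH h <-].
Qed.

End Enumeration.

(** * Blocks of a retraction and the order on their copies *)

Section Blocks.
Context (d : Order.disp_t) (W : omega1 d).
Context (r : W -> W).
Hypothesis r_homo : {homo r : a b / (a <= b)%O}.
Hypothesis r_ge : forall a, (a <= r a)%O.
Hypothesis r_idem : forall a, r (r a) = r a.
Implicit Types (a b c : W) (m n : nat) (l : W * nat).

Lemma retract_lt a b : (r a < r b)%O -> (r a < b)%O.
Proof.
by move=> ab; rewrite ltNge; apply/negP => /r_homo; rewrite r_idem leNgt ab.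
Qed.

(** All copies of a block precede the next block. With the copy number compared first, the whole of
    copy 0, an uncountable set, would lie below copy 1. *)
Definition block_lt l l' : Prop :=
  (r l.1 < r l'.1)%O \/ r l.1 = r l'.1 /\
    ((l.2 < l'.2)%N \/ l.2 = l'.2 /\ (l.1 < l'.1)%O).

Lemma block_lt_wf : well_founded block_lt.
Proof.
move=> [c m]; have [a rc] : exists a, r c = a by exists (r c).
elim/(well_founded_induction (@omega1_lt_wf d W)): a c m rc => a IHa c m.
elim/ltn_ind: m c => m IHm c.
elim/(well_founded_induction (@omega1_lt_wf d W)): c => c IHc rc.
constructor => -[c' m'] [/= lt_r|[/= eq_r [lt_m|[-> lt_c]]]].
- by apply: (IHa (r c')); rewrite -?rc.
- by apply: IHm; rewrite ?eq_r.
- by apply: IHc; rewrite ?eq_r.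
Qed.

Lemma block_lt_total l l' : [\/ block_lt l l', l = l' | block_lt l' l].
Proof.
case: l l' => [c m] [c' m']; rewrite /block_lt /=.
have [rr|rr|rr] := ltgtP (r c) (r c');
  [by constructor 1; left|by constructor 3; left|].
have [mm|mm|mm] := ltngtP m m'; [by constructor 1; right; split; [|left]
  |by constructor 3; right; split; [|left]|].
have [cc|cc|cc] := ltgtP c c'; last by constructor 2; rewrite mm cc.
  by constructor 1; right; split; [|right].
by constructor 3; right; split; [|right].
Qed.

Lemma block_lt_segment l : countable [set l' | block_lt l' l].
Proof.
apply: (@sub_countable _ _ _ ([set c | (c <= r l.1)%O] `*` [set: nat])).
  apply: subset_card_le => -[c m] /= [/= /ltW cl|[/= <- _]]; split => //.
  exact: le_trans (r_ge c) cl.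
by apply: countableX; [exact: omega1_countable_le|exact: countableP].
Qed.

(** [H a i] is the place in [W] of the point [a] in copy [i]; [c] and [m] recover both. Every place
    is taken, so a function on [W] amounts to a family of functions on the copies. *)
Lemma block_enumeration : exists (H : W -> nat -> W) (c : W -> W) (m : W -> nat),
  (forall w, H (c w) (m w) = w) /\
  forall a i b j, (H a i < H b j)%O <-> block_lt (a, i) (b, j).
Proof.
have [|H [Hlt Hsurj]] := @omega1_order_iso d W _ block_lt block_lt_wf block_lt_total
    block_lt_segment.
  move=> cWn; apply: (@omega1_uncountable _ W).
  by apply: (@countable_inj _ _ _ _ (fun c => (c, 0%N)) _ _ cWn) => // c c' _ _ [->].
have [G GK] := choice Hsurj.
exists (fun a i => H (a, i)), (fun w => (G w).1), (fun w => (G w).2).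
split=> [w|a i b j]; first by rewrite -surjective_pairing.
split=> [HH|]; last exact: Hlt.
by have [//|e|/Hlt] := block_lt_total (a, i) (b, j); move: HH;
  rewrite ?e ?ltxx// => /lt_trans h /h; rewrite ltxx.
Qed.

End Blocks.

(** * Gluing functions into the copies and slicing them off again *)

Section GluingAndSlicing.
Context (R : realType) (k : scalar_kind) (d : Order.disp_t) (W : omega1 d).
Context (p : R) (p1 : 1 < p).
Notation K := (scalar_field R k).
Context (r : W -> W).
Hypothesis r_homo : {homo r : a b / (a <= b)%O}.
Hypothesis r_ge : forall a, (a <= r a)%O.
Hypothesis r_idem : forall a, r (r a) = r a.
(** The range of [r] is closed: a limit of block ends is a block end. *)
Hypothesis r_left : forall a b, (b < a)%O ->
  (forall v, (v < a)%O -> exists2 w, (v < w)%O & (w < a)%O) ->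
  (forall c, (c < a)%O -> (r c < a)%O) -> r a = a.
Context (H : W -> nat -> W) (cw : W -> W) (mw : W -> nat).
Hypothesis HK : forall w, H (cw w) (mw w) = w.
Hypothesis H_lt : forall a i b j, (H a i < H b j)%O <-> block_lt r (a, i) (b, j).
Implicit Types (f y : W -> K^o) (x : nat -> W -> K^o) (a b c v w : W).

Local Notation norm f := (fine (norm_p0 p f)).

Lemma H_inj a i b j : H a i = H b j -> a = b /\ i = j.
Proof.
move=> e; have [/H_lt|[-> ->]//|/H_lt] := block_lt_total r (a, i) (b, j);
  by rewrite e ltxx.
Qed.

Lemma cwH a i : cw (H a i) = a.
Proof. by have [] := H_inj (HK (H a i)). Qed.

Lemma mwH a i : mw (H a i) = i.
Proof. by have [] := H_inj (HK (H a i)). Qed.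

Lemma lt_blocks a b : (a < b)%O -> block_lt r (cw a, mw a) (cw b, mw b).
Proof. by rewrite -{1}(HK a) -{1}(HK b) => /H_lt. Qed.

Lemma H_le a b i : r a = r b -> (a <= b)%O -> (H a i <= H b i)%O.
Proof.
move=> ab; rewrite le_eqVlt => /predU1P[->//|lt_ab]; apply/ltW/H_lt.
by right; split=> //; right.
Qed.

Lemma retract_between a b c : (a <= b)%O -> (b <= c)%O -> r a = r c -> r b = r c.
Proof. by move=> ab bc ac; apply/le_anti; rewrite r_homo//= -ac r_homo. Qed.

(* The copy number i + 1 carries [x i]; copy 0 is left blank, because its first
   point may be a limit, whereas the first points of the others are isolated. *)
Definition glue x w : K^o :=
  if mw w is n.+1 then x n (cw w) - x n (r (cw w)) else 0.

(** Subtracting the value at the block end [r c] makes the slice vanish on the range of [r]; the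
    shift [n.+1] skips the blank copy 0. *)
Definition slice y n c : K^o := y (H c n.+1) - y (H (r c) n.+1).

Lemma glueE x c n : glue x (H c n.+1) = x n c - x n (r c).
Proof. by rewrite /glue mwH cwH. Qed.

Lemma glue0E x c : glue x (H c 0) = 0.
Proof. by rewrite /glue mwH. Qed.

Lemma glue_retract x c i : glue x (H (r c) i) = 0.
Proof. by case: i => [|i]; rewrite ?glue0E// glueE r_idem subrr. Qed.

Lemma slice_retract y n c : slice y n (r c) = 0.
Proof. by rewrite /slice r_idem subrr. Qed.

(** * The p-variation of glued functions and of slices *)

(** [m i] labels the copy that holds the interval from [t i] to [t' i]. Disjointness is asked only
    within one copy of one block; the block order or the label separates the rest. *)
Definition block_intervals (I : finType) (Q : pred I) (t t' : I -> W) (m : I -> nat) :=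
  (forall i, Q i -> (t i <= t' i)%O /\ r (t i) = r (t' i)) /\
  (forall i j, Q i -> Q j -> i != j -> m i = m j -> r (t i) = r (t j) ->
     (t' i <= t j \/ t' j <= t i)%O).

Lemma block_intervals_ord n (Q : pred 'I_n) (t t' : 'I_n -> W) (m : 'I_n -> nat) :
  (forall i, Q i -> (t i <= t' i)%O /\ r (t i) = r (t' i)) ->
  (forall i j : 'I_n, Q i -> Q j -> (i < j)%N -> m i = m j -> r (t i) = r (t j) ->
     (t' i <= t j)%O) ->
  block_intervals Q t t' m.
Proof.
move=> tt' sep; split=> // i j Qi Qj ij mij rij.
have [lt_ij|lt_ji|/val_inj e] := ltngtP i j; last by rewrite e eqxx in ij.
  by left; exact: sep.
by right; exact: sep.
Qed.

Lemma block_intervals_tagged N (len : nat -> nat)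
    (Q : pred {n : 'I_N & 'I_(len n)}) (t t' : nat -> nat -> W) :
  (forall n (i : 'I_(len n)), (t n i <= t' n i)%O) ->
  (forall g, Q g -> r (t (tag g) (tagged g)) = r (t' (tag g) (tagged g))) ->
  (forall (n : 'I_N) (i j : 'I_(len n)),
     Q (Tagged _ i) -> Q (Tagged _ j) -> (i < j)%N ->
     r (t n i) = r (t n j) -> (t' n i <= t n j)%O) ->
  block_intervals Q (fun g => t (tag g) (tagged g))
    (fun g => t' (tag g) (tagged g)) (fun g => tag g).
Proof.
move=> tt' rtt' sep; split=> [g /rtt'|[n i] [n' j] Qi Qj + /= /val_inj e] //.
case: _ / e j Qj => j Qj gh rij.
have [ij|ji|/val_inj ij] := ltngtP i j; last by rewrite ij eqxx in gh.
  by left; exact: sep.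
by right; exact: sep.
Qed.

(* The copies of the blocks are disjoint intervals of [W], so the intervals
   inside different copies do not overlap. *)
Lemma sum_enumerated_intervals_le y (I : finType) (Q : pred I) (t t' : I -> W) m :
  (norm_p0 p y < +oo)%E -> block_intervals Q t t' m ->
  \sum_(i | Q i) increment p y (H (t i) (m i).+1) (H (t' i) (m i).+1) <= norm y `^ p.
Proof.
move=> yoo [tt' sep]; apply: (sum_nonoverlap_le p1) => // [i /tt'[? ?]|i j Qi Qj ij].
  exact: H_le.
have [ti ei] := tt' i Qi; have [tj ej] := tt' j Qj.
have [rij|rij|rij] := ltgtP (r (t i)) (r (t j)).
- by left; apply/ltW/H_lt; left; rewrite /= -ei.
- by right; apply/ltW/H_lt; left; rewrite /= -ej.
have [mij|mij|mij] := ltngtP (m i) (m j).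
- by left; apply/ltW/H_lt; right; rewrite /= -ei; split=> //; left.
- by right; apply/ltW/H_lt; right; rewrite /= -ej; split=> //; left.
have [le_ij|le_ji] := sep i j Qi Qj ij mij rij; [left|right].
  by rewrite mij; apply: H_le => //; rewrite -ei.
by rewrite mij; apply: H_le => //; rewrite -ej.
Qed.

(* Different blocks do not overlap either, so for each [n] the intervals with
   [m i = n] compete for the variation of the single function [x n]. *)
Lemma sum_family_intervals_le x B (I : finType) (Q : pred I) (t t' : I -> W) m :
  (forall n, (norm_p0 p (x n) < +oo)%E) ->
  (forall N, \sum_(n < N) norm (x n) `^ p <= B) -> block_intervals Q t t' m ->
  \sum_(i | Q i) increment p (x (m i)) (t i) (t' i) <= B.
Proof.
move=> xoo xB [tt' sep]; pose N := \max_i m i.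
have mN i : (m i < N.+1)%N by rewrite ltnS /N leq_bigmax.
rewrite (partition_big (fun i => inord (m i) : 'I_N.+1) xpredT)//=.
apply: le_trans (xB N.+1); apply: ler_sum => n _.
rewrite (eq_bigr (fun i => increment p (x n) (t i) (t' i))); last first.
  by move=> i /andP[_ /eqP<-]; rewrite inordK.
have mE i : inord (m i) == n -> m i = n by move=> /eqP <-; rewrite inordK.
apply: (sum_nonoverlap_le p1) => // [i /andP[/tt'[]]//|].
move=> i j /andP[Qi /mE mi] /andP[Qj /mE mj] ij.
have [ti ei] := tt' i Qi; have [tj ej] := tt' j Qj.
have [rij|rij|rij] := ltgtP (r (t i)) (r (t j)).
- left; apply: (@le_trans _ _ (r (t i))); first by rewrite ei.
  exact: ltW (retract_lt r_homo r_idem rij).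
- right; apply: (@le_trans _ _ (r (t j))); first by rewrite ej.
  exact: ltW (retract_lt r_homo r_idem rij).
by apply: sep => //; rewrite mi mj.
Qed.

(** Here [same j] will mean that step [j] stays in one copy of a block. Any other step is charged to
    the values at its two ends, each an increment up to the end of its own block. *)
Lemma sum_split_le (f : nat -> K) (same : pred nat) n :
  \sum_(j < n) modulus (f j.+1 - f j) `^ p <=
  \sum_(j < n | same j) modulus (f j.+1 - f j) `^ p +
  2 `^ p * (\sum_(j < n | ~~ same j) modulus (f j) `^ p +
            \sum_(j < n | ~~ same j) modulus (f j.+1) `^ p).
Proof.
rewrite (bigID (fun j : 'I_n => same j)) /= lerD2l -big_split mulr_sumr /=.
apply: ler_sum => j _; rewrite [X in _ * X]addrC; exact: modulusB_powR_le.
Qed.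

(** 1 for steps inside a copy of a block, and 2^p for each end of the other steps. *)
Definition glue_const : R := 1 + 2 `^ p * 2.

Lemma glue_const_ge0 : 0 <= glue_const.
Proof. by rewrite addr_ge0// mulr_ge0// powR_ge0. Qed.

Lemma increasing_upto_le n (a : nat -> W) i j : increasing_upto n a ->
  (i <= j)%N -> (j <= n)%N -> (a i <= a j)%O.
Proof.
move=> an; elim: j => [|j IH]; first by rewrite leqn0 => /eqP ->.
rewrite leq_eqVlt => /predU1P[->//|ij] jn.
exact: le_trans (IH ij (ltnW jn)) (ltW (an _ jn)).
Qed.

(** Steps inside a copy, starts of the other steps and ends of the other steps give three families
    of disjoint block intervals, each with sum at most [B]. *)
Lemma norm_glue_le x B :
  (forall n, (norm_p0 p (x n) < +oo)%E) ->
  (forall N, \sum_(n < N) norm (x n) `^ p <= B) ->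
  (norm_p0 p (glue x) < +oo)%E /\ norm (glue x) `^ p <= glue_const * B.
Proof.
move=> xoo xB; have B0 : 0 <= B by have := xB 0%N; rewrite big_ord0.
apply: (norm_p0_le_powR p1); first by rewrite mulr_ge0// glue_const_ge0.
move=> n a an; pose c j := cw (a j); pose m j := mw (a j).
pose same j := (r (c j) == r (c j.+1)) && (m j == m j.+1).
have step j : (j < n)%N -> block_lt r (c j, m j) (c j.+1, m j.+1).
  by move=> jn; apply: lt_blocks; exact: an.
have rmon i j : (i <= j)%N -> (j <= n)%N -> (r (c i) <= r (c j))%O.
  move=> ij jn; have := increasing_upto_le an ij jn.
  rewrite le_eqVlt => /predU1P[e|].
    by rewrite /c e.
  by move=> /lt_blocks[/= /ltW//|[/= e _]]; rewrite /c e.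
have mmon i j : (i <= j)%N -> (j <= n)%N -> r (c i) = r (c j) -> (m i <= m j)%N.
  move=> ij jn rij; have := increasing_upto_le an ij jn.
  rewrite le_eqVlt => /predU1P[e|].
    by rewrite /m e.
  by move=> /lt_blocks[/=|[/= _ [/ltnW//|[e _]]]]; [rewrite rij ltxx|rewrite /m e].
(* Steps between two chain points in one copy of a block stay there, so each copy is left at most
   once and entered at most once. *)
have same_between i j : (i < j)%N -> (j <= n)%N -> r (c i) = r (c j) ->
    m i = m j -> same i.
  move=> ij jn rij mij; have i1n := leq_trans ij jn.
  have e : r (c i) = r (c i.+1).
    by apply/le_anti; rewrite rmon//= rij; exact: rmon.
  rewrite /same e eqxx /= eqn_leq mmon//= mij; apply: mmon => //.
  by rewrite -rij e.
have glue0 j : m j = 0%N -> glue x (a j) = 0 by move=> e; rewrite /glue -/(m j) e.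
have glueS j : (0 < m j)%N -> modulus (glue x (a j)) `^ p =
    increment p (x (m j).-1) (c j) (r (c j)).
  rewrite /glue -/(m j) -/(c j); case: (m j) => // i _.
  by rewrite /increment -modulusN opprB.
have glueSS j : same j -> modulus (glue x (a j.+1) - glue x (a j)) `^ p =
   if (0 < m j)%N then increment p (x (m j).-1) (c j) (c j.+1) else 0.
  rewrite /glue -/(m j) -/(m j.+1) -/(c j) -/(c j.+1) => /andP[/eqP e /eqP <-].
  case: (m j) => [|i].
    by rewrite subrr modulus0 powR0// gt_eqF// (lt_trans ltr01).
  by rewrite /increment e opprB addrA subrK.
apply: le_trans (sum_split_le (fun j => glue x (a j)) same n) _.
have p0 : p != 0 by rewrite gt_eqF// (lt_trans ltr01).
rewrite mulrDl mul1r -mulrA mulrDl mul1r.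
apply: lerD; last apply: ler_wpM2l; rewrite ?powR_ge0//.
  rewrite (eq_bigr _ (fun (i : 'I_n) => glueSS i)) -big_mkcondr.
  apply: sum_family_intervals_le => //.
  apply: block_intervals_ord => [i /andP[/andP[/eqP ei /eqP mi] _]|].
    split=> //; have [/=|[/= _ [/=|[_ /ltW//]]]] := step i (ltn_ord i).
      by rewrite ei ltxx.
    by rewrite mi ltnn.
  move=> i j /andP[/andP[/eqP ri /eqP mi1] mi] /andP[_ mj] ij mij rij.
  have mij' : m i = m j by rewrite -(prednK mi) -(prednK mj) mij.
  have := increasing_upto_le an ij (ltnW (ltn_ord j)).
  rewrite le_eqVlt => /predU1P[e|]; first by rewrite /c e.
  move=> /lt_blocks[/=|[/= _ [/=|[_ /ltW//]]]].
    by rewrite -/(c i.+1) -/(c j) -ri rij ltxx.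
  by rewrite -/(m i.+1) -/(m j) -mi1 mij' ltnn.
apply: lerD.
  (* Points in the blank copy 0 contribute nothing; each other point starts an interval running to
     its block end. *)
  rewrite (bigID (fun j : 'I_n => (0 < m j)%N)) /= [X in _ + X]big1 ?addr0; last first.
    by move=> j /andP[_]; rewrite -eqn0Ngt => /eqP/glue0 ->; rewrite modulus0 powR0.
  rewrite (eq_bigr _ (fun (i : 'I_n) h => glueS i (proj2 (andP h)))).
  apply: sum_family_intervals_le => //.
  apply: block_intervals_ord => [i _|]; first by rewrite r_idem.
  move=> i j /andP[Si mi] /andP[_ mj] ij mij rij.
  have mij' : m i = m j by rewrite -(prednK mi) -(prednK mj) mij.
  by rewrite (same_between i j ij (ltnW (ltn_ord j)) rij mij') in Si.
rewrite (bigID (fun j : 'I_n => (0 < m j.+1)%N)) /= [X in _ + X]big1 ?addr0; last first.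
  by move=> j /andP[_]; rewrite -eqn0Ngt => /eqP/glue0 ->; rewrite modulus0 powR0.
rewrite (eq_bigr _ (fun (i : 'I_n) h => glueS i.+1 (proj2 (andP h)))).
apply: sum_family_intervals_le => //.
apply: block_intervals_ord => [i _|]; first by rewrite r_idem.
move=> i j /andP[_ mi] /andP[Sj mj] ij mij rij.
have mij' : m i.+1 = m j.+1 by rewrite -(prednK mi) -(prednK mj) mij.
case/negP: Sj; have jn := ltn_ord j.
have e : r (c j) = r (c j.+1).
  by apply/le_anti; rewrite rmon//= -rij; apply: rmon => //; exact: ltnW.
rewrite /same e eqxx /= eqn_leq mmon//= -mij'; apply: mmon => //; first exact: ltnW.
by rewrite rij.
Qed.

(** Chains for different slices sit in different copies, so together they compete for the variation
    of the single function [y]. The steps are grouped as for gluing. *)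
Lemma sum_slice_chains_le y N (len : nat -> nat) (s : nat -> nat -> W) :
  (norm_p0 p y < +oo)%E -> (forall n, increasing_upto (len n) (s n)) ->
  \sum_(n < N) \sum_(j < len n) increment p (slice y n) (s n j) (s n j.+1) <=
  glue_const * norm y `^ p.
Proof.
move=> yoo inc; have p0 : p != 0 by rewrite gt_eqF// (lt_trans ltr01).
pose same n j := r (s n j) == r (s n j.+1).
have rmon n i j : (i <= j)%N -> (j <= len n)%N -> (r (s n i) <= r (s n j))%O.
  by move=> ij jn; apply: r_homo; exact: increasing_upto_le (inc n) ij jn.
have modS n c : modulus (slice y n c) `^ p = increment p y (H c n.+1) (H (r c) n.+1).
  by rewrite /increment -modulusN opprB.
apply: (@le_trans _ _ (\sum_(n < N) (\sum_(j < len n | same n j)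
    increment p y (H (s n j) n.+1) (H (s n j.+1) n.+1) +
    2 `^ p * (\sum_(j < len n | ~~ same n j)
                increment p y (H (s n j) n.+1) (H (r (s n j)) n.+1) +
              \sum_(j < len n | ~~ same n j)
                increment p y (H (s n j.+1) n.+1) (H (r (s n j.+1)) n.+1))))).
  apply: ler_sum => n _.
  apply: le_trans (sum_split_le (fun j => slice y n (s n j)) (same n) (len n)) _.
  rewrite (eq_bigr _ (fun (i : 'I_(len n)) _ => modS n (s n i))).
  rewrite (eq_bigr _ (fun (i : 'I_(len n)) _ => modS n (s n i.+1))).
  rewrite lerD2r; apply: ler_sum => j /eqP e.
  by rewrite /slice e opprB addrA subrK.
rewrite big_split /= -mulr_sumr big_split /= !sig_big_dep /=.
rewrite mulrDl mul1r -mulrA mulrDl mul1r.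
apply: lerD; last apply: ler_wpM2l; rewrite ?powR_ge0//.
  apply: (sum_enumerated_intervals_le yoo).
  apply: (block_intervals_tagged (t := s) (t' := fun n j => s n j.+1)).
  - by move=> n i; exact/ltW/inc.
  - by move=> [n i] /= /eqP.
  - by move=> n i j _ _ ij _; apply: increasing_upto_le (inc n) ij _; exact: ltnW.
apply: lerD.
  apply: (sum_enumerated_intervals_le yoo).
  apply: (block_intervals_tagged (t := s) (t' := fun n j => r (s n j))) => //.
  move=> n i j /= /negP + _ ij rij; case; apply/eqP/le_anti.
  by rewrite rmon//= rij rmon// ltnW.
apply: (sum_enumerated_intervals_le yoo).
apply: (block_intervals_tagged (t := fun n j => s n j.+1)
  (t' := fun n j => r (s n j.+1))) => //.
move=> n i j /= _ /negP + ij rij; case; apply/eqP/le_anti.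
by rewrite rmon//= -rij rmon// ltnW.
Qed.

Lemma norm_p0_approx f e : (norm_p0 p f < +oo)%E -> 0 < e ->
  exists n (a : nat -> W), increasing_upto n a /\
    norm f `^ p <= \sum_(j < n) increment p f (a j) (a j.+1) + e.
Proof.
move=> foo e0; apply: contrapT => nx.
have lt_f n (a : nat -> W) : increasing_upto n a ->
    \sum_(j < n) increment p f (a j) (a j.+1) <= norm f `^ p - e.
  move=> an; rewrite lerBrDr leNgt; apply/negP => /ltW fle; apply: nx.
  by exists n, a.
have [v _] := omega1_inhabited W.
have [|_] := norm_p0_le_powR p1 _ lt_f.
  have inc0 : increasing_upto 0 (fun=> v : W) by [].
  by have := lt_f 0%N _ inc0; rewrite big_ord0.
by rewrite lerBrDr gerDl leNgt e0.
Qed.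

Lemma norm_slice_fin y n : (norm_p0 p y < +oo)%E -> (norm_p0 p (slice y n) < +oo)%E.
Proof.
move=> yoo; apply: (norm_p0_le_powR p1 (M := glue_const * norm y `^ p) _ _).1.
  by rewrite mulr_ge0 ?powR_ge0// glue_const_ge0.
move=> m a am.
(* The chain [a] is used for slice [n], and chains of length 0 for the earlier ones. *)
have := @sum_slice_chains_le y n.+1 (fun i => if i == n then m else 0) (fun=> a) yoo.
rewrite big_ord_recr /= eqxx => chains.
apply: le_trans (chains _); last by move=> i; case: ifP.
by rewrite lerDr; apply: sumr_ge0 => i _; apply: sumr_ge0 => j _; exact: increment_ge0.
Qed.

Lemma sum_norm_slice_le y N : (norm_p0 p y < +oo)%E ->
  \sum_(n < N) norm (slice y n) `^ p <= glue_const * norm y `^ p.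
Proof.
move=> yoo; apply/ler_addgt0Pr => e e0.
(* Each of the [N] slices may lose this much; [N.+1] avoids a zero denominator. *)
have e'0 : 0 < e / N.+1%:R by rewrite divr_gt0.
have /choice[s sP] n : exists ls : nat * (nat -> W), increasing_upto ls.1 ls.2 /\
    norm (slice y n) `^ p <=
    \sum_(j < ls.1) increment p (slice y n) (ls.2 j) (ls.2 j.+1) + e / N.+1%:R.
  by have [l [a ?]] := norm_p0_approx (norm_slice_fin n yoo) e'0; exists (l, a).
apply: (@le_trans _ _ (\sum_(n < N) (\sum_(j < (s n).1)
    increment p (slice y n) ((s n).2 j) ((s n).2 j.+1) + e / N.+1%:R))).
  by apply: ler_sum => n _; have [] := sP n.
rewrite big_split /=; apply: lerD.
  apply: (@sum_slice_chains_le y N (fun n => (s n).1) (fun n => (s n).2)) => // n.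
  by have [] := sP n.
rewrite sumr_const card_ord -[leLHS]mulr_natl mulrCA
  ger_pMr// ler_pdivrMr// mul1r ler_nat.
exact: leqnSn.
Qed.

(** * Continuity of slices and of glued functions *)

(** Copies of blocks are convex in [W], so approach from the left in a copy can be compared with
    approach from the left in its block. *)
Lemma enumerated_between a c i w : r a = r c -> (H a i <= w)%O -> (w < H c i)%O ->
  exists b, [/\ w = H b i, r b = r c, (a <= b)%O & (b < c)%O].
Proof.
rewrite -{1 2}(HK w) => ac aw /H_lt wc.
have [mac rac] : (r a <= r (cw w))%O /\ (r a = r (cw w) -> (i <= mw w)%N).
  move: aw; rewrite le_eqVlt => /predU1P[/H_inj[<- <-]//|/H_lt[/= acw|[/= ->]]].
    by split=> [|e]; [exact: ltW|rewrite e ltxx in acw].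
  by case=> [/ltnW|[->]].
case: wc => [|[/= rc h]]; first by rewrite /= -ac ltNge mac.
have im : (i <= mw w)%N by apply: rac; rewrite ac.
case: h => [|[mi wc]]; first by rewrite ltnNge im.
exists (cw w); split=> //; first by rewrite -mi HK.
move: aw; rewrite mi le_eqVlt => /predU1P[/H_inj[<-]//|/H_lt[/=|[/= _ [/=|[_ /ltW//]]]]].
  by rewrite rc ac ltxx.
by rewrite ltnn.
Qed.

(** A limit point that begins its block is a limit of earlier block ends, hence a block end itself
    by [r_left]. *)
Lemma block_limit c : (exists c0, (c0 < c)%O) ->
  (forall v, (v < c)%O -> exists2 w, (v < w)%O & (w < c)%O) ->
  (exists2 c0, (c0 < c)%O & r c0 = r c) \/
  r c = c /\ (forall c0, (c0 < c)%O -> (r c0 < c)%O).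
Proof.
move=> [b bc] lim_c.
have [|none] := pselect (exists2 c0, (c0 < c)%O & r c0 = r c); first by left.
have rlt c0 : (c0 < c)%O -> (r c0 < c)%O.
  move=> c0c; apply: (retract_lt r_homo r_idem).
  rewrite lt_neqAle (r_homo (ltW c0c)) andbT.
  by apply/eqP => e; apply: none; exists c0.
by right; split=> //; exact: r_left bc lim_c rlt.
Qed.

Lemma james_left y c e : in_james_space p y -> 0 < e -> forall v0, (v0 < c)%O ->
  exists2 v, (v0 <= v < c)%O &
    forall w, (v < w)%O -> (w <= c)%O -> modulus (y w - y c) < e.
Proof.
move=> [cy _ _] e0 v0 vc; have /cvgrPdist_lt/(_ (of_real k e)) := cy c.
rewrite -{1}(of_real0 R k) lt_of_real => /(_ e0)/(nbhs_omega1_left vc)[v vv vP].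
exists v => // w vw wc; have := vP w vw wc.
by rewrite -of_real_modulus lt_of_real -modulusN opprB.
Qed.

Lemma slice_in_james y n : in_james_space p y -> in_james_space p (slice y n).
Proof.
move=> Jy; have [_ _ yoo] := Jy.
apply: (in_james_space_criterion p1); first exact: norm_slice_fin.
- move=> c lim_c v e vc e0.
  have [[c0 c0c rc0]|[rc rlt]] : _ \/ _ :=
    block_limit (ex_intro _ v vc) lim_c; last first.
    (* Block ends accumulate at [c], and the slice vanishes at them and at [c]. *)
    have [v' vv' v'c] := lim_c v vc.
    exists (r v'); split; [exact: lt_le_trans (r_ge v')|exact: rlt|].
    by rewrite slice_retract -rc slice_retract subrr modulus0.
  pose c1 := Order.max v c0.
  have c1c : (c1 < c)%O by rewrite gt_max vc.
  have rc1 : r c1 = r c.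
    by apply: retract_between rc0; [rewrite le_max lexx orbT|exact: ltW].
  have Hc1 : (H c1 n.+1 < H c n.+1)%O.
    by apply/H_lt; right; split=> //; right.
  (* Keeping [w] at or above [H c1 n.+1] makes it a point [H b n.+1] of the same copy. *)
  have [w /andP[c1w wc] wP] := james_left Jy e0 Hc1.
  have [b [wE rb c1b bc]] := enumerated_between rc1 c1w wc.
  have [c' bc' c'c] := lim_c _ bc.
  have rc' : r c' = r c.
    by apply: retract_between rb; exact: ltW.
  exists c'; split=> //.
    by apply: le_lt_trans bc'; apply: le_trans c1b; rewrite le_max lexx.
  rewrite /slice rc' opprB addrA subrK; apply: wP.
    by rewrite wE; apply/H_lt; right; rewrite /= rb rc'; split=> //; right.
  by apply: H_le => //; exact: ltW.
- move=> v; have [s vs _] := omega1_succ v.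
  by exists (r s); [exact: lt_le_trans (r_ge s)|exact: slice_retract].
Qed.

(** A limit point in copy 0 has value 0 and zeros close to its left. A limit point in copy [n.+1] is
    not first there, as the first one immediately follows the last point of copy [n]; so the left
    continuity of [x n] applies. *)
Lemma glue_in_james x B :
  (forall n, in_james_space p (x n)) ->
  (forall N, \sum_(n < N) norm (x n) `^ p <= B) -> in_james_space p (glue x).
Proof.
move=> Jx xB; apply: (in_james_space_criterion p1).
- by apply: (norm_glue_le _ xB).1 => n; have [] := Jx n.
- move=> w lim_w v e vw e0; have [v1 vv1 v1w] := lim_w v vw.
  move wE : (mw w) (HK w) => [|n]; set c := cw w => Hw.
    rewrite -{2}Hw glue0E.
    have [/= rlt|[/= rE [|[m1 cc]]]] := lt_blocks v1w.
    + exists (H (r (cw v1)) (mw v1)); split.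
      * apply: lt_le_trans vv1 _; rewrite -{1}(HK v1); apply: H_le => //.
      * by rewrite -[w]HK; apply/H_lt; left; rewrite /= r_idem.
      * by rewrite glue_retract subrr modulus0.
    + by rewrite wE.
    + exists v1; split=> //.
      by rewrite -[v1]HK m1 wE glue0E subrr modulus0.
  have : exists c3, [/\ r c3 = r c, (c3 < c)%O & (v < H c3 n.+1)%O].
    (* Beyond the last point of copy [n], points below [w] lie in the copy of [w]. *)
    have rcw : (H (r c) n < w)%O.
      by rewrite -Hw; apply/H_lt; right; rewrite /= r_idem; split=> //; left.
    have [|v3] := lim_w (Order.max v (H (r c) n)); first by rewrite gt_max vw.
    rewrite gt_max => /andP[vv3 rcv3] v3w; exists (cw v3).
    move: rcv3 v3w vv3; rewrite -{1 2 3}(HK v3) -{1}Hw => /H_lt + /H_lt.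
    rewrite /block_lt /= r_idem => -[rc3|[rc3 m3]] [c3r|[c3r c3m]].
    - by have := lt_trans rc3 c3r; rewrite ltxx.
    - by rewrite c3r ltxx in rc3.
    - by rewrite rc3 ltxx in c3r.
    have nm3 : (n < mw v3)%N.
      by case: m3 => // -[_ rcc3]; move: (r_ge (cw v3)); rewrite -rc3 leNgt rcc3.
    case: c3m => [|[-> ?]]; first by rewrite ltnS leqNgt nm3.
    by split.
  move=> [c3 [rc3 c3c vc3]].
  have [c5 /andP[c35 c5c] c5P] := james_left (Jx n) e0 c3c.
  have rc5 : r c5 = r c.
    by apply: retract_between rc3 => //; exact: ltW.
  have Hc5 : (H c5 n.+1 < w)%O by rewrite -Hw; apply/H_lt; right; split=> //; right.
  have [w6 c5w6 w6w] := lim_w _ Hc5.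
  have [c6 [w6E rc6 c56 c6c]] : exists b, [/\ w6 = H b n.+1, r b = r c,
      (c5 <= b)%O & (b < c)%O].
    by apply: enumerated_between; rewrite ?Hw// ltW.
  exists w6; split=> //.
    by apply: lt_trans c5w6; apply: lt_le_trans vc3 _; apply: H_le; rewrite ?rc5.
  rewrite w6E -Hw !glueE rc6 opprB addrA subrK; apply: c5P; last exact: ltW.
  by rewrite lt_neqAle c56 andbT; apply/eqP => e56; rewrite w6E e56 ltxx in c5w6.
- move=> v; have [s vs _] := omega1_succ (r (cw v)).
  exists (H (r s) 0); last exact: glue_retract.
  by rewrite -[v]HK; apply/H_lt; left; rewrite /= r_idem; exact: lt_le_trans (r_ge s).
Qed.

End GluingAndSlicing.

(** * Weak neighbourhoods and functionals vanishing on a dense span *)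

Section WeakTopology.
Context (K : numFieldType) (X : normedModType K).

Lemma nbhs_weak (f : dual X) (a : X) (U : set K^o) :
  nbhs (f a) U -> nbhs (a : weak X) (f @^-1` U).
Proof.
move=> aU; have /cvg_sup/(_ f) h : nbhs (a : weak X) --> (a : weak X) by exact: cvg_id.
apply: h; exact: (@initial_continuous X K^o (f : X -> K^o) a U aU).
Qed.

Lemma dense_span_vanish (f : dual X) (A : set X) : dense (linear_span A) ->
  (forall a, A a -> f a = 0) -> forall u, f u = 0.
Proof.
move=> dA A0 u; have [M fM] := (bounded_opP f).2.
apply/eqP; apply/negPn/negP => fu0.
(* The scalar [M] has no known sign, hence the modulus; adding 1 makes the radius below well
   defined. *)
have M0 : 0 < `|M| + 1 by rewrite ltr_wpDl.
have e0 : 0 < `|f u| / (`|M| + 1) by rewrite divr_gt0// normr_gt0.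
have [||v [/interior_subset uv [n [t [a [Aa vE]]]]]] :=
  dA (ball u (`|f u| / (`|M| + 1)))^°.
- by exists u; apply: nbhsx_ballx.
- exact: open_interior.
have fv : f v = 0.
  rewrite vE raddf_sum big1// => i _; have := (bounded_opP f).1 (t i) (a i) 0.
  by rewrite addr0 (A0 (a i))// scaler0 add0r raddf0.
move: uv; rewrite -ball_normE /ball_ /= ltr_pdivlMr// => uv.
have Mr : M * `|u - v| <= `|M| * `|u - v|.
  have h : 0 <= M * `|u - v| by exact: le_trans (fM (u - v)).
  by rewrite -(ger0_norm h) normrM normr_id.
have := le_trans (fM (u - v)) Mr; rewrite raddfB /= fv subr0 => /le_lt_trans h.
have : `|M| * `|u - v| < `|f u|.
  by apply: le_lt_trans uv; rewrite mulrC ler_wpM2l// lerDl.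
by move/h; rewrite ltxx.
Qed.

Lemma subspace_valE (Y : closed_subspace X) (t : K) (u v : subspace_type Y) :
  subspace_val (t *: u + v) = t *: subspace_val u + subspace_val v.
Proof. by []. Qed.

End WeakTopology.

Lemma james_funE (R : realType) (k : scalar_kind) (d : Order.disp_t) (W : omega1 d)
    (p : R) (p1 : 1 < p) (t : scalar_field R k) (u v : james_space k W p1) c :
  (t *: u + v) c = t * u c + v c.
Proof. by []. Qed.

(** * Common zeros of a weakly compact set *)

Section WeaklyCompactlyGenerated.
Context (R : realType) (k : scalar_kind) (d : Order.disp_t) (W : omega1 d).
Context (p : R) (p1 : 1 < p).
Notation K := (scalar_field R k).
Notation X := (james_space k W p1).
Implicit Types (a b c : W).

Context (Y : closed_subspace X).
Notation val u := (subspace_val (u : subspace_type Y)).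

Lemma subspace_eval_subproof c :
  (fun u : subspace_type Y => (val u : W -> K^o) c) \in
    @bounded_linear_pred K (subspace_type Y) K^o.
Proof.
rewrite inE; split.
  by move=> t u v; rewrite subspace_valE james_funE.
by exists 1 => u; rewrite mul1r; exact: modulus_james.
Qed.

Definition subspace_eval c : dual (subspace_type Y) :=
  BoundedOp (subspace_eval_subproof c).

Context (A : set (subspace_type Y)).
Hypothesis A_compact : weakly_compact A.

Lemma weakly_compact_small b (e : R) : 0 < e -> exists c, forall u, A u ->
  exists w, [/\ (b < w)%O, (w <= c)%O & modulus ((val u : W -> K^o) w) < e].
Proof.
move=> e0; apply: contrapT => nc; pose big c := [set u | A u /\
  forall w, (b < w)%O -> (w <= c)%O -> e <= modulus ((val u : W -> K^o) w)].
have bigN0 c : big c !=set0.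
  apply: contrapT => big0; apply: nc; exists c => u Au.
  apply: contrapT => nw; apply: big0; exists u; split=> // w bw wc.
  by rewrite leNgt; apply/negP => we; apply: nw; exists w.
pose F : set_system (weak (subspace_type Y)) := filter_from setT big.
have FF : ProperFilter F.
  apply: filter_from_proper => //; apply: filter_from_filter; first by exists b.
  move=> c c' _ _; exists (Order.max c c') => // u [Au uP].
  by split; split=> // w bw wc; apply: uP; rewrite // le_max wc ?orbT.
have [|u [Au uF]] := A_compact FF.
  by exists b => // u [].
have [_ u0 _] := james_spaceP (val u).
have F1 := to_omega1_filter W.
have of_e0 : 0 < of_real k e by rewrite -(of_real0 R k) lt_of_real.
have [v _ vP] : to_omega1 [set w | `|0 - (val u : W -> K^o) w| < of_real k e].
  by move/cvgrPdist_lt : u0; apply.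
have [s bs _] := omega1_succ b; pose w := Order.max s v.
have bw : (b < w)%O by rewrite lt_max bs.
have uw : `|0 - (val u : W -> K^o) w| < of_real k e.
  by apply: vP; rewrite /= le_max lexx orbT.
(* Evaluation at [w] is weakly continuous, so some element of [big w] is also smaller than [e] at
   [w]. *)
have nU : nbhs (subspace_eval w u) [set z : K^o | `|z| < of_real k e].
  have := @cvgr_norm_lt K K^o _ (nbhs (subspace_eval w u)) _ id _ cvg_id (of_real k e).
  by apply; move: uw; rewrite sub0r normrN.
have [|u' [[_ u'P]]] := uF (big w) _ _ (nbhs_weak nU); first by exists w.
have := u'P w bw (lexx w); rewrite -(le_of_real k) of_real_modulus => eu'.
by move=> /(le_lt_trans eu'); rewrite ltxx.
Qed.

(* At a point [c] closed under [g], continuity would spread a nonzero value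
   over an interval [(b, c]], against [weakly_compact_small]. *)
Lemma weakly_compact_vanish : exists g : W -> W, (forall b, (b < g b)%O) /\
  forall c, (exists b, (b < c)%O) -> (forall b, (b < c)%O -> (g b <= c)%O) ->
  forall u, A u -> (val u : W -> K^o) c = 0.
Proof.
(* One point beyond the bounds for all precisions [1 / n.+1] serves every later [e]. *)
have /choice[g gP] b : exists c, (b < c)%O /\ forall n u, A u -> exists w,
    [/\ (b < w)%O, (w <= c)%O & modulus ((val u : W -> K^o) w) < n.+1%:R^-1].
  have n0 n : 0 < n.+1%:R^-1 :> R by rewrite invr_gt0.
  have /choice[h hP] := fun n => weakly_compact_small b (n0 n).
  have [|c cP] := @omega1_ubound _ W (range h `|` [set b]).
    apply: (@sub_countable _ _ _ (\bigcup_(t in [set: bool])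
      (if t then range h else [set b]))).
      by apply: subset_card_le => x [hx|bx]; [exists true|exists false].
    apply: bigcup_countable => //= -[] _; last exact: countable1.
    exact: sub_countable (card_image_le _ _) (countableP _).
  exists c; split; first by apply: cP; right.
  move=> n u /(hP n)[w [bw wh uw]]; exists w; split=> //.
  by apply: le_trans wh (ltW _); apply: cP; left; exists n.
exists g; split=> [b|c [b0 b0c] gc u Au]; first by have [] := gP b.
apply: modulus0_eq0; apply/eqP; rewrite eq_le modulus_ge0 andbT leNgt.
apply/negP => uc; pose e := modulus ((val u : W -> K^o) c) / 2.
have e0 : 0 < e by rewrite divr_gt0.
have [b /andP[_ bc] bP] := james_left (james_spaceP (val u)) e0 b0c.
(* This precision is below [e], which would put the modulus at [c] below [e + e], its own value. *)
have [_ /(_ (Num.truncn e^-1) u Au)[w [bw wg uw]]] := gP b.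
have ne : (Num.truncn e^-1).+1%:R^-1 < e.
  by rewrite invf_plt ?posrE// truncnS_gt.
have := bP w bw (le_trans wg (gc b bc)).
have := modulusD ((val u : W -> K^o) w) ((val u : W -> K^o) c - (val u : W -> K^o) w).
rewrite addrC subrK -(modulusN (_ - _)) opprB => tri wc.
have := le_lt_trans tri (ltrD (lt_trans uw ne) wc).
by rewrite -splitr ltxx.
Qed.

End WeaklyCompactlyGenerated.

(** * Retraction onto a closed unbounded set *)

Section ClubRetraction.
Context (d : Order.disp_t) (W : omega1 d).

(** Closing off: [h b] exceeds [g] at all points up to [b], and [a] is the supremum of the iterates
    of [h] from [c]. A point below [a] is below some iterate, and [g] sends it below the next. *)
Lemma omega1_iter_ubound (g : W -> W) (c : W) : (forall b, (b < g b)%O) ->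
  exists a, [/\ (c <= a)%O, (exists b, (b < a)%O) &
    forall b, (b < a)%O -> (g b <= a)%O].
Proof.
move=> gb; have /choice[h hP] b : exists a, forall b', (b' <= b)%O -> (g b' < a)%O.
  have [|a aP] := @omega1_ubound _ W (g @` [set b' | (b' <= b)%O]).
    exact: sub_countable (card_image_le _ _) (omega1_countable_le b).
  by exists a => b' bb'; apply: aP; exists b'.
pose s n := iter n h c.
have [|m mP] := @omega1_ubound _ W (range s).
  exact: sub_countable (card_image_le _ _) (countableP _).
have [|a aP amin] := @omega1_well_ordered _ W [set a | forall n, (s n <= a)%O].
  by exists m => n; apply/ltW/mP; exists n.
have ca : (c < a)%O.
  by apply: lt_le_trans (aP 1%N); apply: lt_trans (gb c) _; exact: hP.
exists a; split; [exact: ltW|by exists c|move=> b ba].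
have [n bn] : exists n, (b < s n)%O.
  apply: contrapT => nb; move: ba; rewrite ltNge => /negP; apply; apply: amin => n.
  by rewrite leNgt; apply/negP => bn; apply: nb; exists n.
by apply: le_trans (aP n.+1); apply/ltW/hP/ltW.
Qed.

(** [D] consists of the points, other than the least, that are closed under [g], and [r c] is its
    first point from [c] on. *)
Lemma club_retraction (g : W -> W) : (forall b, (b < g b)%O) ->
  exists r : W -> W, [/\ {homo r : a b / (a <= b)%O}, (forall a, (a <= r a)%O),
    (forall a, r (r a) = r a),
    (forall a b, (b < a)%O ->
       (forall v, (v < a)%O -> exists2 w, (v < w)%O & (w < a)%O) ->
       (forall c, (c < a)%O -> (r c < a)%O) -> r a = a) &
    forall a, (exists b, (b < r a)%O) /\ forall b, (b < r a)%O -> (g b <= r a)%O].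
Proof.
move=> gb; pose D a := (exists b, (b < a)%O) /\ forall b, (b < a)%O -> (g b <= a)%O.
have /choice[r rP] c : exists a,
    [/\ (c <= a)%O, D a & forall b, (c <= b)%O -> D b -> (a <= b)%O].
  have [a [ca a1 a2]] := omega1_iter_ubound c gb.
  have [|m [cm Dm] mmin] := @omega1_well_ordered _ W [set a | (c <= a)%O /\ D a].
    by exists a.
  by exists m; split=> // b cb Db; apply: mmin.
have r_ge a : (a <= r a)%O by have [] := rP a.
have rD a : D (r a) by have [] := rP a.
have r_fix a : D a -> r a = a.
  by move=> Da; apply/le_anti; rewrite r_ge andbT; have [_ _] := rP a; exact.
exists r; split=> //.
- by move=> a b ab; have [_ _] := rP a; apply => //; exact: le_trans ab _.
- by move=> a; exact: r_fix.
- move=> a b ba lim_a ra; apply: r_fix; split; first by exists b.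
  (* With [c < e < a], the point [r e] of [D] yields [g c <= r e < a]. *)
  move=> c /lim_a[e ce ea]; have [_ gP] := rD e.
  by apply: le_trans (ltW (ra e ea)); apply: gP; exact: lt_le_trans ce (r_ge e).
Qed.

End ClubRetraction.

(** * Pointwise computation with bounded operators *)

Section OperatorExtensionality.
Context (K : numFieldType) (X Y : normedModType K).

Lemma bounded_op_ext (f g : bounded_op X Y) : (forall u, f u = g u) -> f = g.
Proof.
by move=> fg; apply: val_inj; apply: functional_extensionality_dep => u; exact: fg.
Qed.

Lemma bounded_op_linear (f : bounded_op X Y) (t : K) u v :
  f (t *: u + v) = t *: f u + f v.
Proof. exact: (bounded_opP f).1. Qed.

Lemma bounded_op_0E u : (0 : bounded_op X Y) u = 0.
Proof. by []. Qed.

Lemma bounded_op_1E (v : X) : (1 : bounded_op X X) v = v.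
Proof. by []. Qed.

Lemma bounded_op_subE (f g : bounded_op X Y) u : (f - g) u = f u - g u.
Proof. by []. Qed.

Lemma bounded_op_mulE (f g : bounded_op X X) u : (f * g) u = f (g u).
Proof. by []. Qed.

End OperatorExtensionality.

(** * Operators on the James space *)

Section JamesOperators.
Context (R : realType) (k : scalar_kind) (d : Order.disp_t) (W : omega1 d).
Context (p : R) (p1 : 1 < p).
Notation K := (scalar_field R k).
Notation X := (james_space k W p1).
Implicit Types (u v : X) (a b c w : W).

Definition vnorm u : R := fine (norm_p0 p (u : W -> K^o)).

Lemma james_vnormE u : `|u| = of_real k (vnorm u).
Proof. exact: james_normE. Qed.

Lemma vnorm_ge0 u : 0 <= vnorm u.
Proof. by apply: fine_norm_p0_ge0; have [_ _ ?] := james_spaceP u. Qed.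

Lemma james_ext u v : (forall c, u c = v c) -> u = v.
Proof. by move=> uv; apply: val_inj; apply: functional_extensionality_dep. Qed.

Lemma vnorm0 : vnorm 0 = 0.
Proof.
have h : `|0 : X| = of_real k (vnorm 0) := james_vnormE 0.
by apply: (@of_real_inj R k); rewrite -h normr0 of_real0.
Qed.

Lemma james_subE u v c : (u - v) c = u c - v c.
Proof. by []. Qed.

Lemma in_james_ex (f : W -> K^o) : in_james_space p f ->
  exists u : X, (u : W -> K^o) = f.
Proof. by move=> Jf; exists (JamesSpace p1 (mem_set Jf)). Qed.

(** The block estimates come in p-th powers; taking the p-th root of the constant gives an operator
    bound. *)
Lemma bounded_op_intro (f : X -> X) (C : R) :
  (forall t u v c, f (t *: u + v) c = t * f u c + f v c) ->
  (forall u, vnorm (f u) `^ p <= C * vnorm u `^ p) ->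
  exists F : bounded_op X X, forall u, F u = f u.
Proof.
move=> fl fC; have p0 : 0 < p by exact: lt_trans p1.
suff fb : f \in @bounded_linear_pred K X X by exists (BoundedOp fb).
rewrite inE; split.
  by move=> t u v; apply: james_ext => c; rewrite fl james_funE.
pose C' := Num.max C 0; exists (of_real k (C' `^ p^-1)) => u.
rewrite (james_vnormE u) (james_vnormE (f u)).
rewrite -of_realM le_of_real.
have C'0 : 0 <= C' by rewrite le_max lexx orbT.
rewrite -[leLHS](@powRVK _ p p1) ?vnorm_ge0//.
rewrite -[X in _ * X](@powRVK _ p p1) ?vnorm_ge0//.
rewrite -powRM ?powR_ge0//; apply: ge0_ler_powR;
  rewrite ?invr_ge0 ?nnegrE ?mulr_ge0 ?powR_ge0 ?(ltW p0)//.
by apply: le_trans (fC u) _; rewrite ler_wpM2r ?powR_ge0// le_max lexx.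
Qed.

Lemma bounded_op_vnorm (F : bounded_op X X) : exists2 C : R, 0 <= C &
  forall u, vnorm (F u) `^ p <= C * vnorm u `^ p.
Proof.
have p0 : 0 < p by exact: lt_trans p1.
have [M FM] := (bounded_opP F).2; exists (modulus M `^ p); first exact: powR_ge0.
move=> u; rewrite -powRM ?modulus_ge0 ?vnorm_ge0//.
apply: ge0_ler_powR;
  rewrite ?nnegrE ?mulr_ge0 ?vnorm_ge0 ?modulus_ge0 ?(ltW p0)//.
rewrite -(le_of_real k) of_realM of_real_modulus.
have h : `|F u| <= M * `|u| := FM u.
have h0 : 0 <= M * `|u| by exact: le_trans h.
have -> : `|M| * of_real k (vnorm u) = M * `|u|.
  by rewrite -(ger0_norm h0) normrM normr_id.
exact: h.
Qed.

End JamesOperators.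

(** * Slicing, gluing and shifting as operators *)

Section ShiftDecomposition.
Context (R : realType) (k : scalar_kind) (d : Order.disp_t) (W : omega1 d).
Context (p : R) (p1 : 1 < p).
Notation K := (scalar_field R k).
Notation X := (james_space k W p1).
Notation B := (bounded_op X X).
Context (r : W -> W).
Hypothesis r_homo : {homo r : a b / (a <= b)%O}.
Hypothesis r_ge : forall a, (a <= r a)%O.
Hypothesis r_idem : forall a, r (r a) = r a.
Hypothesis r_left : forall a b, (b < a)%O ->
  (forall v, (v < a)%O -> exists2 w, (v < w)%O & (w < a)%O) ->
  (forall c, (c < a)%O -> (r c < a)%O) -> r a = a.
Context (H : W -> nat -> W) (cw : W -> W) (mw : W -> nat).
Hypothesis HK : forall w, H (cw w) (mw w) = w.
Hypothesis H_lt : forall a i b j, (H a i < H b j)%O <-> block_lt r (a, i) (b, j).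
Implicit Types (u v : X) (a b c w : W).

Lemma slice_op_exists : exists L : nat -> B,
  (forall n u c, L n u c = u (H c n.+1) - u (H (r c) n.+1)) /\
  exists C, forall N u, \sum_(n < N) vnorm (L n u) `^ p <= C * vnorm u `^ p.
Proof.
have /choice[s sE] (nu : nat * X) : exists v : X,
    (v : W -> K^o) = slice r H (nu.2 : W -> K^o) nu.1.
  apply: in_james_ex.
  exact: (slice_in_james p1 r_homo r_ge r_idem r_left HK H_lt _ (james_spaceP nu.2)).
have sE' n u c : s (n, u) c = u (H c n.+1) - u (H (r c) n.+1) by rewrite sE.
have sC N u : \sum_(n < N) vnorm (s (n : nat, u)) `^ p <= glue_const p * vnorm u `^ p.
  have [_ _ uoo] := james_spaceP u.
  apply: le_trans (sum_norm_slice_le p1 r_homo r_ge r_idem H_lt N uoo).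
  by apply: ler_sum => n _; rewrite /vnorm sE.
have /choice[L LE] n : exists F : B, forall u, F u = s (n, u).
  apply: (@bounded_op_intro _ _ _ _ _ _ (fun u => s (n, u)) (glue_const p)).
    by move=> t u v c; rewrite !sE' !james_funE mulrBr opprD addrACA.
  move=> u; apply: le_trans (sC n.+1 u); rewrite big_ord_recr /= lerDr.
  by apply: sumr_ge0 => i _; exact: powR_ge0.
exists L; split; first by move=> n u c; rewrite LE sE'.
exists (glue_const p) => N u; apply: le_trans (sC N u).
by apply: ler_sum => n _; rewrite LE.
Qed.

Lemma glue_op_exists (F : nat -> B) :
  (exists C, forall N u, \sum_(n < N) vnorm (F n u) `^ p <= C * vnorm u `^ p) ->
  exists G : B, forall u, (G u : W -> K^o) = glue r cw mw (fun n => F n u).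
Proof.
move=> [C FC].
have /choice[g gE] u : exists v : X, (v : W -> K^o) = glue r cw mw (fun n => F n u).
  apply: in_james_ex.
  apply: (glue_in_james p1 r_homo r_ge r_idem HK H_lt
    (B := C * vnorm u `^ p)).
    by move=> n; exact: james_spaceP.
  by move=> N; exact: FC.
have [||G GE] := @bounded_op_intro _ _ _ _ _ p1 g (glue_const p * C).
- move=> t u v c; rewrite !gE /glue; case: (mw c) => [|n]; first by rewrite mulr0 addr0.
  by rewrite !bounded_op_linear !james_funE mulrBr opprD addrACA.
- move=> u; rewrite -mulrA /vnorm gE.
  apply: (norm_glue_le p1 r_homo r_ge r_idem HK H_lt _ _).2 => [n|N]; last exact: FC.
  by have [] := james_spaceP (F n u).
by exists G => u; rewrite GE gE.
Qed.

(* [L n] reads off the n-th copy, [R0] writes into copy 0, [U] and [V] shift the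
   copies down and up, and [S] applies [T] in every copy. *)
Lemma shift_operators (T : B) : (forall u c, T u (r c) = 0) ->
  exists P L0 R0 S U V : B, [/\ P * T = T, P * L0 = L0, L0 * R0 = P,
    S * U * V = S & S - V * (S * U) = R0 * T * L0].
Proof.
move=> Tr; have [L [LE [C LC]]] := slice_op_exists.
have p0 : p != 0 by rewrite gt_eqF// (lt_trans ltr01 p1).
have v0 : vnorm (0 : X) `^ p = 0.
  by rewrite vnorm0 powR0.
(* Index 0 of the family is stored in the copy numbered 1. *)
have [R0 R0E] : exists G : B, forall u, (G u : W -> K^o) =
    glue r cw mw (fun n => (if n is 0 then 1 else 0 : B) u).
  apply: glue_op_exists; exists 1 => -[|N] u; first by rewrite big_ord0 mul1r powR_ge0.
  by rewrite big_ord_recl big1 ?addr0 ?mul1r// => i _; rewrite bounded_op_0E v0.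
have [U UE] : exists G : B, forall u, (G u : W -> K^o) =
    glue r cw mw (fun n => L n.+1 u).
  apply: glue_op_exists; exists C => N u; apply: le_trans (LC N.+1 u).
  by rewrite big_ord_recl lerDr powR_ge0.
(* Shifting up leaves index 0 empty; this gap makes [S] and [V * (S * U)] differ. *)
have [V VE] : exists G : B, forall u, (G u : W -> K^o) =
    glue r cw mw (fun n => (if n is m.+1 then L m else 0) u).
  have C_ge0 u : 0 <= C * vnorm u `^ p by have := LC 0%N u; rewrite big_ord0.
  apply: glue_op_exists; exists C => -[|N] u.
    by rewrite big_ord0.
  rewrite big_ord_recl.
  rewrite [X in X + _](_ : _ = 0); last exact: v0.
  rewrite add0r; apply: le_trans (LC N u).
  by apply: ler_sum => n _; exact: lexx.
have [S SE] : exists G : B, forall u, (G u : W -> K^o) =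
    glue r cw mw (fun n => (T * L n) u).
  have [M M0 TM] := bounded_op_vnorm T.
  apply: glue_op_exists; exists (M * C) => N u; rewrite -mulrA.
  apply: le_trans (ler_wpM2l M0 (LC N u)); rewrite mulr_sumr.
  by apply: ler_sum => n _; rewrite bounded_op_mulE.
have LrE n u c : L n u (r c) = 0 by rewrite LE r_idem subrr.
(* Reading a glued family returns [F n u] corrected to vanish on the range of [r], which changes
   nothing if it vanishes there already. *)
have Lglue (G : B) (F : nat -> X -> X) n u c :
    (forall u, (G u : W -> K^o) = glue r cw mw (fun n => F n u)) ->
    L n (G u) c = F n u c - F n u (r c).
  by move=> GE; rewrite LE GE !(glueE HK H_lt) r_idem subrr subr0.
have LR0 u c : L 0%N (R0 u) c = u c - u (r c) by rewrite (Lglue _ _ _ _ _ R0E).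
have LU n u : L n (U u) = L n.+1 u.
  by apply: james_ext => c; rewrite (Lglue _ _ _ _ _ UE) LrE subr0.
have LV n u : L n.+1 (V u) = L n u.
  by apply: james_ext => c; rewrite (Lglue _ _ _ _ _ VE) LrE subr0.
have LS n u : L n (S u) = T (L n u).
  by apply: james_ext => c; rewrite (Lglue _ _ _ _ _ SE) bounded_op_mulE Tr subr0.
(* As a product, the projection taking [u] to [u - u o r] needs no separate proof that it acts
   boundedly on the space. *)
exists (L 0%N * R0), (L 0%N), R0, S, U, V; split=> //.
- apply: bounded_op_ext => u; rewrite !bounded_op_mulE.
  by apply: james_ext => c; rewrite LR0 Tr subr0.
- apply: bounded_op_ext => u; rewrite !bounded_op_mulE.
  by apply: james_ext => c; rewrite LR0 LrE subr0.
- apply: bounded_op_ext => u; rewrite !bounded_op_mulE; apply: james_ext => c.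
  rewrite !SE /glue; case: (mw c) => // n.
  by rewrite !bounded_op_mulE LU LV.
- apply: bounded_op_ext => u; rewrite bounded_op_subE !bounded_op_mulE.
  apply: james_ext => c; rewrite james_subE SE VE R0E /glue.
  (* The blank copy, index 0, where [V] contributes nothing, and higher indices, where the two terms
     cancel. *)
  case: (mw c) => [|[|n]]; first by rewrite subrr.
  + by rewrite bounded_op_0E bounded_op_1E subrr subr0.
  + by rewrite !bounded_op_0E !bounded_op_mulE LS LU !subrr.
Qed.

End ShiftDecomposition.

(** * The commutator identity and the conclusion *)

(** As [P N = N] and [N P = 0], the first commutator is [N = T - T P]; the second is [T P - R0 T L0]
    and the third [R0 T L0]. *)
Lemma sum_three_commutators (A : pzRingType) (T P L0 R0 S U V : A) :
  P * T = T -> P * L0 = L0 -> L0 * R0 = P -> S * U * V = S ->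
  S - V * (S * U) = R0 * T * L0 ->
  exists C1 C2 C3, [/\ commutator C1, commutator C2, commutator C3 & T = C1 + C2 + C3].
Proof.
move=> PT PL LR SUV RTL; pose N := T - T * P.
have PP : P * P = P by rewrite -{2}LR mulrA PL.
exists (P * N - N * P), (L0 * (R0 * T * P) - (R0 * T * P) * L0),
  (S * U * V - V * (S * U)).
split; [by exists P, N|by exists L0, (R0 * T * P)|by exists (S * U), V|].
rewrite SUV RTL /N mulrBr mulrBl -[T * P * P]mulrA PP subrr subr0 mulrA PT.
by rewrite !mulrA LR PT -[_ * P * L0]mulrA PL -addrA !subrK.
Qed.

Theorem theorem3p11 (R : realType) (k : scalar_kind) (d : Order.disp_t)
    (W : omega1 d) (p : R) (p1 : 1 < p)
    (T : bounded_op (james_space k W p1) (james_space k W p1)) :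
  WCG_operators T ->
  exists C1 C2 C3 : bounded_op (james_space k W p1) (james_space k W p1),
    [/\ commutator C1, commutator C2, commutator C3 & T = C1 + C2 + C3].
Proof.
move=> [Y [[A [cA dA]] TY]].
have [g [gb g0]] := weakly_compact_vanish cA.
have [r [r_homo r_ge r_idem r_left rg]] := club_retraction gb.
have Tr u c : T u (r c) = 0.
  have Tu : T u \in subspace_pred Y by apply: mem_set; apply: TY; exists u.
  (* Evaluation at [r c] vanishes on [A], hence on the whole subspace, which contains the range of
     [T]. *)
  have := dense_span_vanish dA (f := subspace_eval Y (r c)) _ (SubspaceElement Tu).
  by apply; apply: g0; have [] := rg c.
have [H [cw [mw [HK H_lt]]]] := block_enumeration r_ge.
have [P [L0 [R0 [S [U [V [PT PL LR SUV RTL]]]]]]] :=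
  shift_operators r_homo r_ge r_idem r_left HK H_lt Tr.
exact: sum_three_commutators PT PL LR SUV RTL.
Qed.
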